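(* Let $\mathbf F\subset\mathcal P_2(\mathsf{TX})$ be an MPVF whose barycentric field $\bar{\mathbf F}$ is totally $\lambda$-dissipative, $\lambda\in\mathbb R$. Let $\tau,T,L>0$ with $\lambda_+\tau\le2$ and $\tau<1$. Let $\bar\mu,\tilde\mu\in D(\mathbf F)$ with $W_2(\bar\mu,\tilde\mu)<1$, and let $(M_\tau,\mathbf F_\tau,\boldsymbol\eta_\tau)\in\mathscr T(\bar\mu,\tau,T,L)$ and $(\tilde M_\tau,\tilde{\mathbf F}_\tau,\tilde{\boldsymbol\eta}_\tau)\in\mathscr T(\tilde\mu,\tau,T,L)$. Then there exists a constant $C$ depending only on $L,T,\lambda$ such that $$W_{2,\infty}(\boldsymbol\eta_\tau,\tilde{\boldsymbol\eta}_\tau)\le C\big(W_2(\bar\mu,\tilde\mu)^{1/2}+\tau^{1/4}\big).$$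
   Context: $\lambda_+=\max\{\lambda,0\}$. $\mathsf X$ separable Hilbert space; $\mathsf{TX}=\mathsf X\times\mathsf X$; $\mathcal P_2$, $W_2$, $\Gamma(\mu,\nu)$ standard; $W_{2,\infty}$ is the quadratic Wasserstein distance on $\mathcal P_2(\mathrm C([0,T];\mathsf X))$ with sup norm. $\mathsf x(x,v)=x$, $\exp^t(x,v)=x+tv$, $|\Phi|_2^2=\int|v|^2d\Phi$. MPVF: nonempty $\mathbf F\subset\mathcal P_2(\mathsf{TX})$, $D(\mathbf F)=\{\mathsf x_\sharp\Phi\}$, $\mathbf F[\mu]=\{\Phi\in\mathbf F:\mathsf x_\sharp\Phi=\mu\}$. Barycentric field $\bar{\mathbf F}[\mu]=\{(\mathrm{id},b_\Phi)_\sharp\mu:\Phi\in\mathbf F[\mu]\}$ with $b_\Phi(x)=\int v\,d\Phi_x(v)$, $\{\Phi_x\}$ the disintegration of $\Phi$ w.r.t. $\mathsf x_\sharp\Phi$. Totally $\lambda$-dissipative: $\int\langle v_1-v_0,x_1-x_0\rangle d\vartheta\le\lambda\int|x_1-x_0|^2d\vartheta$ for all $\Phi_0,\Phi_1$ in the field and all $\vartheta\in\Gamma(\Phi_0,\Phi_1)$. Explicit Euler scheme: $N=\lceil T/\tau\rceil$; an $L$-stable solution from $\bar\mu$ is $(M^n,\Phi^n)_{0\le n\le N}\subset D(\mathbf F)\times\mathbf F$ with $M^0=\bar\mu$, $\Phi^n\in\mathbf F[M^n]$, $|\Phi^n|_2\le L$ ($0\le n<N$), $M^n=(\exp^\tau)_\sharp\Phi^{n-1}$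 ($1\le n\le N$). Interpolants $M_\tau(t)=(\exp^{t-n\tau})_\sharp\Phi^n$ for $t\in[n\tau,(n+1)\tau]$, $\mathbf F_\tau(t)=\Phi^{\lfloor t/\tau\rfloor}$. Single-step plans $T^n=(\mathsf x,\exp^\tau)_\sharp\Phi^n$ with disintegrations $\{T^n_x\}$ w.r.t. the first marginal; multi-step plan $\alpha^1=T^0$, $\alpha^n=\int\delta_{(x_0,\dots,x_{n-1})}\otimes T^{n-1}_{x_{n-1}}d\alpha^{n-1}$, $\alpha_\tau=\alpha^N$; $\boldsymbol\eta_\tau=G_\sharp\alpha_\tau$, where $G(x_0,\dots,x_N)$ is the curve on $[0,T]$ affine on each $[n\tau,(n+1)\tau]\cap[0,T]$ with $\gamma(n\tau)=x_n$. $\mathscr T(\bar\mu,\tau,T,L)$ is the set of triples $(M_\tau,\mathbf F_\tau,\boldsymbol\eta_\tau)$ obtained from $L$-stable solutions starting from $\bar\mu$. *)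

(* Defs.v *)
From HB Require Import structures.
From mathcomp Require Import all_boot all_order all_algebra.
From mathcomp Require Import all_classical all_reals all_analysis measurable_realfun.



Unset Printing Implicit Defensive.

Import Order.TTheory GRing.Theory Num.Theory.
Local Open Scope classical_set_scope.
Local Open Scope ring_scope.

Section Generic.
Variable R : realType.

Definition coupling {d1 d2} {T1 : measurableType d1} {T2 : measurableType d2}
  (mu : probability T1 R) (nu : probability T2 R)
  (gam : probability (T1 * T2)%type R) : Prop :=
  (forall A, measurable A -> gam (A `*` setT) = mu A) /\
  (forall B, measurable B -> gam (setT `*` B) = nu B).

Definition W2 {d} {T : measurableType d} (dist : T -> T -> R)
  (mu nu : probability T R) : \bar R :=
  sqrte (ereal_inf [set (\int[gam]_p ((dist p.1 p.2) ^+ 2)%:E)%E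
                   | gam in [set gam | coupling mu nu gam]]).

Definition mom2_finite {d} {T : measurableType d} (sq : T -> R)
  (mu : probability T R) : Prop :=
  (\int[mu]_x (sq x)%:E < +oo)%E.

Definition marg1 {d1 d2} {T1 : measurableType d1} {T2 : measurableType d2}
  (Phi : set (T1 * T2) -> \bar R) (mu : probability T1 R) : Prop :=
  forall A, measurable A -> Phi (A `*` setT) = mu A.

Definition disintegrates {d1 d2} {T1 : measurableType d1} {T2 : measurableType d2}
  (Phi : set (T1 * T2) -> \bar R) (mu : probability T1 R)
  (K : T1 -> probability T2 R) : Prop :=
  (forall B, measurable B -> measurable_fun [set: T1] (K ^~ B)) /\
  (forall A B, measurable A -> measurable B ->
     Phi (A `*` B) = (\int[mu]_(x in A) K x B)%E).

End Generic.
Arguments coupling {R d1 d2 T1 T2}.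
Arguments W2 {R d T}.
Arguments mom2_finite {R d T}.
Arguments marg1 {R d1 d2 T1 T2}.
Arguments disintegrates {R d1 d2 T1 T2}.

Section Hilbert.
Variable R : realType.

Definition hilbert_ip (X : normedModType R) (ip : X -> X -> R) : Prop :=
  (forall x y, ip x y = ip y x) /\
  (forall (a : R) x y z, ip (a *: x + y) z = a * ip x z + ip y z) /\
  (forall x, ip x x = `|x| ^+ 2).

Definition separable_space (X : topologicalType) : Prop :=
  exists D : set X, countable D /\ closure D = setT.

End Hilbert.

Section Spaces.
Variables (R : realType) (X : completeNormedModType R).

Definition BX := g_sigma_algebraType (@open X).
Definition BXm : measurableType _ := BX.

(* TX = X x X (product sigma-algebra = Borel, X being separable) *)
Definition TX : measurableType _ := Measurable.clone _ (BX * BX)%type _.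

Definition mpair {d1 d2} (A : measurableType d1) (B : measurableType d2)
  : {d : measure_display & measurableType d} :=
  existT _ _ (Measurable.clone _ (A * B)%type _).

(* Xpow n = X^{n+1}, points (x_0, ..., x_n) stored as nested pairs *)
Fixpoint Xpow (n : nat) : {d : measure_display & measurableType d} :=
  match n with
  | 0 => existT _ _ BXm
  | n.+1 => mpair (projT2 (Xpow n)) BXm
  end.

Definition Xp (n : nat) := projT2 (Xpow n).

Fixpoint coord (n : nat) : Xp n -> nat -> X :=
  match n return Xp n -> nat -> X with
  | 0 => fun x _ => (x : X)
  | n.+1 => fun x k => if k == n.+1 then (x.2 : X) else coord n x.1 k
  end.

Definition last_coord (n : nat) (x : Xp n) : X := coord n x n.

Definition expt (t : R) (p : TX) : X := (p.1 : X) + t *: (p.2 : X).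

Definition cont_on (T : R) (f : R -> X) : Prop := {within `[0, T], continuous f}.
Definition CX (T : R) := {f : R -> X | cont_on T f}.

Lemma cont_on_cst (T : R) : cont_on T (fun _ => 0).
Proof. apply: continuous_subspaceT => x; exact: cst_continuous. Qed.

Definition cx0 (T : R) : CX T := exist _ _ (cont_on_cst T).
HB.instance Definition _ (T : R) := gen_eqMixin (CX T).
HB.instance Definition _ (T : R) := gen_choiceMixin (CX T).
HB.instance Definition _ (T : R) := isPointed.Build (CX T) (cx0 T).

Definition supdist (T : R) (f g : CX T) : R :=
  sup [set `|sval f t - sval g t| | t in `[0, T]].

Definition cx_open (T : R) : set (set (CX T)) :=
  [set U | forall f : CX T, U f -> exists2 r : R, 0 < r &
                      forall g : CX T, supdist T f g < r -> U g].

Definition BCX (T : R) : measurableType _ := g_sigma_algebraType (cx_open T).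

Definition interp (tau T : R) (N : nat) (x : Xp N) (t : R) : X :=
  let s := Num.max 0 (Num.min t T) in
  let k := minn (Num.truncn (s / tau)) N.-1 in
  coord N x k + ((s - k%:R * tau) / tau) *: (coord N x k.+1 - coord N x k).

Definition Gpath (tau T : R) (N : nat) (x : Xp N) : BCX T :=
  match pselect (cont_on T (interp tau T N x)) with
  | left h => exist _ _ h
  | right _ => cx0 T
  end.

End Spaces.

Section MPVF.
Variables (R : realType) (X : completeNormedModType R) (ip : X -> X -> R).

Local Notation BX := (BXm R X).
Local Notation TX := (TX R X).

Definition P2X (mu : probability BX R) : Prop :=
  mom2_finite (fun x : BX => `|(x : X)| ^+ 2) mu.
Definition P2TX (Phi : probability TX R) : Prop :=
  mom2_finite (fun p : TX => `|(p.1 : X)| ^+ 2 + `|(p.2 : X)| ^+ 2) Phi.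

Definition MPVF (F : set (probability TX R)) : Prop :=
  F !=set0 /\ (forall Phi, F Phi -> P2TX Phi).

Definition inD (F : set (probability TX R)) (mu : probability BX R) : Prop :=
  exists2 Phi, F Phi & marg1 Phi mu.

(* b is the barycenter of Phi: b(x) = \int v dPhi_x(v) for mu-a.e. x, where
   {Phi_x} is the disintegration of Phi w.r.t. mu = x_# Phi; the X-valued
   integral is understood weakly (tested against every y in X). *)
Definition barycenter (Phi : probability TX R) (mu : probability BX R)
  (b : BX -> BX) : Prop :=
  marg1 Phi mu /\ measurable_fun [set: BX] b /\
  exists K : BX -> probability BX R,
    disintegrates Phi mu K /\
    {ae mu, forall x : BX, forall y : X,
        (ip (b x : X) y)%:E = (\int[K x]_v (ip (v : X) y)%:E)%E}.

Definition bar_field (F : set (probability TX R)) : set (probability TX R) :=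
  [set Psi | exists Phi mu b, F Phi /\ barycenter Phi mu b /\
     (forall E, measurable E ->
        Psi E = pushforward mu (fun x : BX => ((x, b x) : TX)) E)].

Definition tot_dissipative (lam : R) (G : set (probability TX R)) : Prop :=
  forall Phi0 Phi1, G Phi0 -> G Phi1 ->
  forall th : probability (TX * TX)%type R, coupling Phi0 Phi1 th ->
  (\int[th]_q (ip ((q.2.2 : X) - (q.1.2 : X)) ((q.2.1 : X) - (q.1.1 : X)))%:E
   <= lam%:E * \int[th]_q (`|(q.2.1 : X) - (q.1.1 : X)| ^+ 2)%:E)%E.

Definition vnorm2 (Phi : probability TX R) : \bar R :=
  sqrte (\int[Phi]_p (`|(p.2 : X)| ^+ 2)%:E)%E.

Definition Nsteps (tau T : R) : nat := `|Num.ceil (T / tau)|%N.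

Definition stable_solution (F : set (probability TX R)) (tau T L : R)
  (mu0 : probability BX R) (M : nat -> probability BX R)
  (Phi : nat -> probability TX R) : Prop :=
  let N := Nsteps tau T in
  (forall A, measurable A -> M 0%N A = mu0 A) /\
  (forall n, (n <= N)%N -> F (Phi n) /\ marg1 (Phi n) (M n)) /\
  (forall n, (n < N)%N -> (vnorm2 (Phi n) <= L%:E)%E) /\
  (forall n, (0 < n <= N)%N -> forall A, measurable A ->
      M n A = pushforward (Phi n.-1) (fun p : TX => (expt R X tau p : BX)) A).

Definition step_plan (tau : R) (Phi : probability TX R) : set (BX * BX) -> \bar R :=
  pushforward Phi (fun p : TX => ((p.1, expt R X tau p) : BX * BX)).

Definition multistep_plan (tau T : R) (M : nat -> probability BX R)
  (Phi : nat -> probability TX R)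
  (alpha : forall n, probability (Xp R X n) R) : Prop :=
  let N := Nsteps tau T in
  exists K : nat -> BX -> probability BX R,
    (forall n, (n < N)%N -> disintegrates (step_plan tau (Phi n)) (M n) (K n)) /\
    (forall E, measurable E -> alpha 1%N E = step_plan tau (Phi 0%N) E) /\
    (forall m, (1 <= m)%N -> (m.+1 <= N)%N ->
       forall E : set (Xp R X m.+1), measurable E ->
       alpha m.+1 E =
       (\int[alpha m]_x K m (last_coord R X m x) (xsection E x))%E).

(* eta belongs to some triple of T(mu0, tau, T, L) *)
Definition scheme_curve_law (F : set (probability TX R)) (tau T L : R)
  (mu0 : probability BX R) (eta : probability (BCX R X T) R) : Prop :=
  exists (M : nat -> probability BX R) (Phi : nat -> probability TX R)
         (alpha : forall n, probability (Xp R X n) R),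
    stable_solution F tau T L mu0 M Phi /\
    multistep_plan tau T M Phi alpha /\
    (forall B, measurable B ->
       eta B = pushforward (alpha (Nsteps tau T))
                 (Gpath R X tau T (Nsteps tau T)) B).

End MPVF.

Definition distX (R : realType) (X : completeNormedModType R) (x y : BXm R X) : R :=
  `|(x : X) - (y : X)|.
Arguments distX {R X}.
Definition distCX (R : realType) (X : completeNormedModType R) (T : R)
  (f g : BCX R X T) : R := supdist R X T f g.

(* Main.v *)
Require Import Defs.
From HB Require Import structures.
From mathcomp Require Import all_boot all_order all_algebra.
From mathcomp Require Import all_classical all_reals all_analysis measurable_realfun.
From mathcomp Require Import lra ring.
Import Order.TTheory GRing.Theory Num.Theory.
Import numFieldNormedType.Exports.
Local Open Scope classical_set_scope.
Local Open Scope ring_scope.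

Set Implicit Arguments.
Unset Strict Implicit.

(** Start from an almost optimal coupling of the initial measures and let the
    two Markov chains with transition kernels [K1], [K2] run independently given
    their starting points. Let [D_n] be the difference of the two positions and
    [u_n] the difference of the two velocities at step [n]. Conditionally on the
    positions, the mean velocities are the barycenters, so total dissipativity
    of the barycentric field bounds [E <u_n, D_n>] by [lam E |D_n|^2], whence
    [E |D_{n+1}|^2 <= (1 + 2 lam^+ tau) E |D_n|^2 + 4 L^2 tau^2] and
    [E |D_n|^2 <= C (W^2 + tau)]. Moreover
    [sup_n |D_n|^2 <= |D_0|^2 + \sum_n (2 tau |u_n| |D_n| + tau^2 |u_n|^2)], whose
    expectation is at most [C (W + sqrt tau)] by AM-GM at scale
    [W + sqrt tau]. The square root of this is the claimed rate. *)

(** * Kernels and couplings *)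

(** Total dissipativity speaks of arbitrary couplings, so it applies to whatever joint law of
    positions the two chains have reached: no optimality has to be propagated in time. Conditional
    independence makes the pairing of velocity and position differences depend on the barycenters
    only; fluctuations enter through second moments, at order [tau ^+ 2] per step and hence order
    [tau] over the [N] steps. The supremum is bounded by adding up increments in place of a maximal
    inequality; the price is that its mean square is of order [W + sqrt tau], while at a fixed time
    it is of order the square of this.

    The rest of the work is measurability. A barycenter must be constructed as a measurable map
    before dissipativity can be applied to it; separability is what puts the open sets of the nested
    products [Xp] into their product sigma-algebras; and the supremum distance on path space is
    handled through a measurable function that dominates it. *)

Lemma integral_cst_probability {R : realType} {d} {T : measurableType d}
    (P : probability T R) (c : \bar R) : (\int[P]_x c = c)%E.
Proof.
rewrite (integral_cst P measurableT c).
by rewrite [X in (_ * X)%E](probability_setT P) mule1.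
Qed.

Section PushforwardProbability.
Context {R : realType} {d1 d2} {T1 : measurableType d1} {T2 : measurableType d2}.
Variables (P : probability T1 R) (f : T1 -> T2).
Hypothesis mf : measurable_fun setT f.

Let mfun_f : {mfun T1 >-> T2} := HB.pack f (isMeasurableFun.Build _ _ _ _ f mf).

Definition pushp : probability T2 R := distribution P mfun_f.

Lemma ge0_integral_pushp (g : T2 -> \bar R) : measurable_fun setT g ->
  (forall y, 0 <= g y)%E -> (\int[pushp]_y g y = \int[P]_x g (f x))%E.
Proof.
move=> mg g0; rewrite (eq_measure_integral (pushforward P f))//.
by rewrite ge0_integral_pushforward//= preimage_setT.
Qed.

Lemma integral_pushp (g : T2 -> \bar R) : measurable_fun setT g ->
  P.-integrable setT (g \o f) -> (\int[pushp]_y g y = \int[P]_x g (f x))%E.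
Proof.
move=> mg ig; rewrite (eq_measure_integral (pushforward P f))//.
by rewrite integral_pushforward//= preimage_setT.
Qed.

Import HBNNSimple.

(* The integral of a nonnegative function is a lower integral, hence [g] need
   not be measurable. *)
Lemma integral_pushp_le (g : T2 -> \bar R) (h : T1 -> \bar R) :
  measurable_fun setT h -> (forall y, 0 <= g y)%E ->
  (forall x, g (f x) <= h x)%E ->
  (\int[pushp]_y g y <= \int[P]_x h x)%E.
Proof.
move=> mh g0 gh; rewrite ge0_integralTE//.
apply: ge_ereal_sup => _ [s /= sg <-].
rewrite -integralT_nnsfun ge0_integral_pushp//.
- apply: ge0_le_integral => //.
  + by move=> x _; rewrite lee_fin.
  + by apply/measurable_EFinP; apply: measurableT_comp.
  + by move=> x _; apply: le_trans (gh x); exact: sg.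
- exact/measurable_EFinP.
- by move=> y; rewrite lee_fin.
Qed.

End PushforwardProbability.

(** Rectangles generate the product sigma-algebra and are stable under intersection. Since
    [disintegrates] prescribes values on rectangles only, this is what extends it to all measurable
    sets. *)
Lemma probability_rect_unique {R : realType} {d1 d2} {T1 : measurableType d1}
    {T2 : measurableType d2} (P Q : probability (T1 * T2)%type R) :
  (forall A B, measurable A -> measurable B -> P (A `*` B) = Q (A `*` B)) ->
  forall E, measurable E -> P E = Q E.
Proof.
move=> PQ E mE.
apply: (@measure_unique _ R _ [set A `*` B | A in measurable & B in measurable]
  (fun=> setT)) => //.
- exact: measurable_prod_measurableType.
- move=> _ _ [X1 mX1 [X2 mX2 <-]] [Y1 mY1 [Y2 mY2 <-]].
  exists (X1 `&` Y1); first exact: measurableI.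
  by exists (X2 `&` Y2); [exact: measurableI|rewrite setXI].
- by move=> _; exists setT => //; exists setT => //; rewrite setXTT.
- by rewrite bigcup_const.
- by move=> _ [A mA [B mB <-]]; exact: PQ.
- by move=> _; rewrite (@le_lt_trans _ _ 1%E) ?ltry// probability_le1.
Qed.

Section SemidirectProduct.
Context {R : realType} {d1 d2} {T1 : measurableType d1} {T2 : measurableType d2}.
Variables (P : probability T1 R) (K : T1 -> probability T2 R).
Hypothesis mK : forall B, measurable B -> measurable_fun setT (K ^~ B).

(** The law of [(x, y)] with [y] drawn from [K x]. Carrying [x] along turns the semidirect product
    into a composition of kernels, started from the constant kernel [P] on a one-point space. *)
Let pairk (z : unit * T1) : {measure set (T1 * T2)%type -> \bar R} :=
  pushp (K z.2) (pair1_measurable z.2).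

Let kcst (_ : unit) : {measure set T1 -> \bar R} := P.

Let kerK (x : T1) : {measure set T2 -> \bar R} := K x.
HB.instance Definition _ := isKernel.Build _ _ _ _ R kerK mK.
Let kerK1 x : kerK x setT = 1%E. Proof. exact: probability_setT. Qed.
HB.instance Definition _ := Kernel_isProbability.Build _ _ _ _ R kerK kerK1.

Lemma measurable_kernel_xsection (E : set (T1 * T2)) : measurable E ->
  measurable_fun setT (fun x => K x (xsection E x)).
Proof.
by move=> mE; apply: (measurable_fun_xsection_finite_kernel kerK); rewrite inE.
Qed.

Let mkcst B : measurable B -> measurable_fun setT (kcst ^~ B).
Proof. by move=> mB; exact: measurable_cst. Qed.
HB.instance Definition _ := isKernel.Build _ _ _ _ R kcst mkcst.
Let kcst1 x : kcst x setT = 1%E. Proof. exact: probability_setT. Qed.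
HB.instance Definition _ := Kernel_isProbability.Build _ _ _ _ R kcst kcst1.

Let mpairk B : measurable B -> measurable_fun setT (pairk ^~ B).
Proof.
move=> mB; rewrite /pairk /=.
rewrite (_ : (fun _ => _) = (fun x => K x (xsection B x)) \o snd); last first.
  by apply/funext => -[u x] /=; rewrite xsectionE.
by apply: measurableT_comp => //; exact: measurable_kernel_xsection.
Qed.
HB.instance Definition _ := isKernel.Build _ _ _ _ R pairk mpairk.
Let pairk1 x : pairk x setT = 1%E. Proof. exact: probability_setT. Qed.
HB.instance Definition _ := Kernel_isProbability.Build _ _ _ _ R pairk pairk1.

Definition semid_fun of (forall B, measurable B -> measurable_fun setT (K ^~ B))
  : set (T1 * T2) -> \bar R := mkcomp kcst pairk tt.

HB.instance Definition _ := Measure.on (semid_fun mK).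

Lemma semid_setT : semid_fun mK setT = 1%E.
Proof.
transitivity (\int[P]_x cst 1%E x)%E.
  by apply: eq_integral => x _; exact: pairk1.
exact: integral_cst_probability.
Qed.

HB.instance Definition _ := Measure_isProbability.Build _ _ _
  (semid_fun mK) semid_setT.

Definition semid : probability (T1 * T2)%type R := semid_fun mK.

Lemma semidE E : semid E = (\int[P]_x K x (xsection E x))%E.
Proof. by apply: eq_integral => x _ /=; rewrite xsectionE. Qed.

Lemma measurable_integral_kernel (f : T1 * T2 -> \bar R) :
  (forall z, 0 <= f z)%E -> measurable_fun setT f ->
  measurable_fun setT (fun x => \int[K x]_y f (x, y))%E.
Proof.
move=> f0 mf.
rewrite (_ : (fun _ => _) = (fun x => \int[pairk (tt, x)]_z f z)%E); last first.
  by apply/funext => x; apply/esym/(ge0_integral_pushp (K x) (pair1_measurable x)).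
apply: measurable_fun_integral_kernel => // U mU.
by apply: (measurableT_comp (mpairk mU)); exact: pair1_measurable.
Qed.

Lemma ge0_integral_semid (f : T1 * T2 -> \bar R) :
  (forall z, 0 <= f z)%E -> measurable_fun setT f ->
  (\int[semid]_z f z = \int[P]_x \int[K x]_y f (x, y))%E.
Proof.
move=> f0 mf; rewrite (integral_kcomp kcst pairk tt f0 mf).
by apply: eq_integral => x _; exact: (ge0_integral_pushp (K x) (pair1_measurable x)).
Qed.

Lemma semid_rect A B : semid (A `*` B) = (\int[P]_(x in A) K x B)%E.
Proof.
rewrite semidE [RHS]integral_mkcond; apply: eq_integral => x _.
rewrite patchE; have [xA|xA] := boolP (x \in A); first by rewrite in_xsectionX.
by rewrite notin_xsectionX// measure0.
Qed.

End SemidirectProduct.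

Lemma disintegrates_semid {R : realType} {d1 d2} {T1 : measurableType d1}
    {T2 : measurableType d2} (Q : probability (T1 * T2)%type R)
    (P : probability T1 R) (K : T1 -> probability T2 R)
    (mK : forall B, measurable B -> measurable_fun setT (K ^~ B)) :
  disintegrates Q P K -> forall E, measurable E -> Q E = semid P mK E.
Proof.
move=> [_ QE]; apply: probability_rect_unique => A B mA mB.
by rewrite semid_rect QE.
Qed.

Section JointExtension.
Context {R : realType} {d1 d2 e1 e2} {S1 : measurableType d1}
  {S2 : measurableType d2} {Y1 : measurableType e1} {Y2 : measurableType e2}.
Variables (P : probability (S1 * S2)%type R).
Variables (K1 : S1 -> probability Y1 R) (K2 : S2 -> probability Y2 R).
Hypothesis mK1 : forall B, measurable B -> measurable_fun setT (K1 ^~ B).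
Hypothesis mK2 : forall B, measurable B -> measurable_fun setT (K2 ^~ B).

Let L1 (s : S1 * S2) := K1 s.1.
Let L2 (s : S1 * S2 * Y1) := K2 s.1.2.

Let mL1 B : measurable B -> measurable_fun setT (L1 ^~ B).
Proof. by move=> mB; exact: (measurableT_comp (mK1 mB)). Qed.

Let mL2 B : measurable B -> measurable_fun setT (L2 ^~ B).
Proof.
move=> mB; apply: (measurableT_comp (mK2 mB)).
exact: (measurableT_comp measurable_snd).
Qed.

(** Two successive extensions produce [(((s1, s2), y1), y2)]; regrouping attaches each new point to
    its own past. *)
Let shuffle (z : S1 * S2 * Y1 * Y2) := ((z.1.1.1, z.1.2), (z.1.1.2, z.2)).

Let mshuffle : measurable_fun setT shuffle.
Proof.
apply: measurable_fun_pair; apply: measurable_fun_pair => //.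
- by apply: measurableT_comp => //; exact: measurableT_comp.
- exact: measurableT_comp.
- by apply: measurableT_comp => //; exact: measurableT_comp.
Qed.

(* Conditionally on [(s1, s2)] drawn from [P], the new coordinates are
   independent with laws [K1 s1] and [K2 s2]. *)
Definition joint_ext : probability ((S1 * Y1) * (S2 * Y2))%type R :=
  pushp (semid (semid P mL1) mL2) mshuffle.

Lemma ge0_integral_joint_ext (f : (S1 * Y1) * (S2 * Y2) -> \bar R) :
  (forall z, 0 <= f z)%E -> measurable_fun setT f ->
  (\int[joint_ext]_z f z =
   \int[P]_s \int[K1 s.1]_y1 \int[K2 s.2]_y2 f ((s.1, y1), (s.2, y2)))%E.
Proof.
move=> f0 mf.
have mfs : measurable_fun setT (f \o shuffle) by exact: measurableT_comp.
have fs0 z : (0 <= (f \o shuffle) z)%E by exact: f0.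
rewrite ge0_integral_pushp// (ge0_integral_semid _ mL2 fs0 mfs).
rewrite (ge0_integral_semid P mL1 (f := fun z =>
  (\int[L2 z]_y (f \o shuffle) (z, y))%E))// => [z|].
  exact: integral_ge0.
exact: (measurable_integral_kernel mL2 fs0 mfs).
Qed.

Lemma measurable_joint_inner (f : (S1 * Y1) * (S2 * Y2) -> \bar R) :
  (forall z, 0 <= f z)%E -> measurable_fun setT f ->
  measurable_fun setT (fun s : S1 * S2 =>
   \int[K1 s.1]_y1 \int[K2 s.2]_y2 f ((s.1, y1), (s.2, y2)))%E.
Proof.
move=> f0 mf.
have mfs : measurable_fun setT (f \o shuffle) by exact: measurableT_comp.
have fs0 z : (0 <= (f \o shuffle) z)%E by exact: f0.
apply: (measurable_integral_kernel mL1 (f := fun z =>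
  (\int[L2 z]_y (f \o shuffle) (z, y))%E)) => [z|].
  exact: integral_ge0.
exact: (measurable_integral_kernel mL2 fs0 mfs).
Qed.

Variables (P1 : probability S1 R) (P2 : probability S2 R).
Hypothesis cP : coupling P1 P2 P.

Let ge0_indic d (T : measurableType d) (A : set T) (z : T) :
  (0 <= (\1_A z : R)%:E)%E.
Proof. by rewrite lee_fin. Qed.

(** For each marginal the new coordinate of the other side integrates to one. What remains depends
    on one component of the old pair, whose law is known from [cP]. *)
Lemma joint_ext_coupling : coupling (semid P1 mK1) (semid P2 mK2) joint_ext.
Proof.
split=> [A mA|A mA].
- have mf : measurable_fun setT (fun z => (\1_A z : R)%:E).
    exact/measurable_EFinP/measurable_indic.
  have mE : measurable (A `*` [set: S2 * Y2]) by exact: measurableX.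
  rewrite -(setIT (A `*` _)) -(integral_indic joint_ext)//.
  rewrite ge0_integral_joint_ext//; last exact/measurable_EFinP/measurable_indic.
  rewrite -[in RHS](setIT A) -(integral_indic (semid P1 mK1))//.
  rewrite ge0_integral_semid//.
  transitivity (\int[pushp P measurable_fst]_x
      \int[K1 x]_y (\1_A (x, y) : R)%:E)%E; last first.
    apply: eq_measure_integral => C mC _; rewrite -[RHS](cP.1 _ mC)/=.
    by congr (P _); apply/seteqP; split => [] [a b] /= // [].
  rewrite ge0_integral_pushp//; last 2 first.
  - exact: (measurable_integral_kernel mK1 _ mf).
  - by move=> x; exact: integral_ge0.
  apply: eq_integral => -[s1 s2] _ /=; apply: eq_integral => y1 _.
  rewrite -[RHS](integral_cst_probability (K2 s2)).
  apply: eq_integral => y2 _; rewrite /= !indicE; congr (_ _)%:R%:E.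
  by apply/idP/idP; rewrite !inE => // -[].
- have mf : measurable_fun setT (fun z => (\1_A z : R)%:E).
    exact/measurable_EFinP/measurable_indic.
  have mE : measurable ([set: S1 * Y1] `*` A) by exact: measurableX.
  rewrite -(setIT (_ `*` A)) -(integral_indic joint_ext)//.
  rewrite ge0_integral_joint_ext//; last exact/measurable_EFinP/measurable_indic.
  rewrite -[in RHS](setIT A) -(integral_indic (semid P2 mK2))//.
  rewrite ge0_integral_semid//.
  transitivity (\int[pushp P measurable_snd]_x
      \int[K2 x]_y (\1_A (x, y) : R)%:E)%E; last first.
    apply: eq_measure_integral => C mC _; rewrite -[RHS](cP.2 _ mC)/=.
    by congr (P _); apply/seteqP; split => [] [a b] /= // [].
  rewrite ge0_integral_pushp//; last 2 first.
  - exact: (measurable_integral_kernel mK2 _ mf).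
  - by move=> x; exact: integral_ge0.
  apply: eq_integral => -[s1 s2] _ /=.
  rewrite -[RHS](integral_cst_probability (K1 s1)).
  apply: eq_integral => y1 _; apply: eq_integral => y2 _.
  rewrite /= !indicE; congr (_ _)%:R%:E.
  by apply/idP/idP; rewrite !inE => // -[].
Qed.

End JointExtension.

(** * Borel structure of a separable space *)

Section SeparableDistance.
Context {R : realType}.

(** [sdist_ball] links the distance to the sigma-algebra. The interface is stable under products,
    and so provides Borel measurability on the spaces [Xp], which are given as measurable types
    without a topology. *)
Record separable_dist {d} {T : measurableType d} (rho : T -> T -> R) := {
  sdist_sym : forall x y, rho x y = rho y x;
  sdist_triangle : forall x y z, rho x z <= rho x y + rho y z;
  sdist_dense : exists c : nat -> T,
    forall x e, 0 < e -> exists i, rho (c i) x < e;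
  sdist_ball : forall x r, measurable [set y | rho x y < r] }.

Definition dist_open {T : Type} (rho : T -> T -> R) (U : set T) :=
  forall x, U x -> exists2 r, 0 < r & forall y, rho x y < r -> U y.

(** By separability, [U] is the union of the countably many balls it contains among those centred on
    the dense sequence with radius [n.+1%:R^-1]. *)
Lemma dist_open_measurable {d} {T : measurableType d} (rho : T -> T -> R) U :
  separable_dist rho -> dist_open rho U -> measurable U.
Proof.
move=> sd oU; have [c dc] := sdist_dense sd.
pose B i n := [set y | rho (c i) y < n.+1%:R^-1].
pose F i n := if pselect (B i n `<=` U) then B i n else set0.
rewrite (_ : U = \bigcup_i \bigcup_n F i n); last first.
  apply/seteqP; split => [x Ux|x [i _ [n _]]]; last first.
    by rewrite /F; case: pselect => // BU /BU.
  have [r r0 rU] := oU _ Ux.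
  have /ltr_add_invr[n] : 0 < r / 2 by rewrite divr_gt0.
  rewrite add0r => nr; have [//|i ci] := dc x n.+1%:R^-1.
  exists i => //; exists n => //; rewrite /F; case: pselect => //= -[] y /= By.
  apply: rU; apply: le_lt_trans (sdist_triangle sd _ (c i) _) _.
  rewrite (splitr r) (sdist_sym sd x (c i)).
  exact: ltrD (lt_trans ci nr) (lt_trans By nr).
apply: bigcupT_measurable => i; apply: bigcupT_measurable => n.
by rewrite /F; case: pselect => ? /=; [exact: (sdist_ball sd)|exact: measurable0].
Qed.

(** Balls for the maximum of two distances are rectangles of balls, hence measurable. *)
Lemma separable_dist_prod {d1 d2} {T1 : measurableType d1}
    {T2 : measurableType d2} (rho1 : T1 -> T1 -> R) (rho2 : T2 -> T2 -> R) :
  separable_dist rho1 -> separable_dist rho2 ->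
  separable_dist (fun x y : T1 * T2 => Num.max (rho1 x.1 y.1) (rho2 x.2 y.2)).
Proof.
move=> s1 s2; split.
- by move=> x y; rewrite (sdist_sym s1) (sdist_sym s2).
- move=> x y z; rewrite ge_max; apply/andP; split.
    apply: le_trans (sdist_triangle s1 _ y.1 _) _.
    by rewrite lerD// le_max lexx.
  apply: le_trans (sdist_triangle s2 _ y.2 _) _.
  by rewrite lerD// le_max lexx orbT.
- have [c1 d1c] := sdist_dense s1; have [c2 d2c] := sdist_dense s2.
  exists (fun k => let p := odflt (0, 0)%N (unpickle k) in (c1 p.1, c2 p.2)).
  move=> x e e0; have [i ci] := d1c x.1 _ e0; have [j cj] := d2c x.2 _ e0.
  by exists (pickle (i, j)); rewrite pickleK /= gt_max ci cj.
- move=> x r; rewrite (_ : mkset _ =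
    [set y | rho1 x.1 y < r] `*` [set y | rho2 x.2 y < r]).
    by apply: measurableX; [exact: (sdist_ball s1)|exact: (sdist_ball s2)].
  by apply/seteqP; split => y /=; rewrite gt_max => /andP.
Qed.

Lemma dist_open_measurable_fun {d} {T : measurableType d} {U : pointedType}
    (G : set (set U)) (rho : T -> T -> R) (f : T -> g_sigma_algebraType G) :
  separable_dist rho ->
  (forall A, G A -> dist_open rho (f @^-1` A)) -> measurable_fun setT f.
Proof.
move=> sd fG; apply: (@measurability _ _ _ _ setT f G) => //.
move=> _ [A GA <-]; rewrite setTI.
exact: dist_open_measurable sd (fG _ GA).
Qed.

End SeparableDistance.

Section BorelVectorSpace.
Context {R : realType} {X : completeNormedModType R}.
Local Notation BX := (BXm R X).

Lemma open_normP (U : set X) :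
  open U -> dist_open (fun x y : X => `|x - y|) U.
Proof.
move=> oU x Ux; have /nbhs_ballP[r r0 rU] : nbhs x U by exact: open_nbhs_nbhs.
by exists r => // y xy; apply: rU; rewrite -ball_normE.
Qed.

Lemma continuous_measurable_BX (f : X -> X) : continuous f ->
  measurable_fun [set: BX] (f : BX -> BX).
Proof.
move=> cf; apply: (@measurability _ _ BX BX setT f (@open X)) => //.
move=> _ [A oA <-]; rewrite setTI; apply: sub_sigma_algebra.
by move/continuousP : cf; exact.
Qed.

Lemma continuous_measurable_real (f : X -> R) : continuous f ->
  measurable_fun [set: BX] f.
Proof.
move=> cf; apply: (measurability _ (RGenOpens.measurableE R)).
move=> _ [_ [a [b ->] <-]]; rewrite setTI; apply: sub_sigma_algebra.
by move/continuousP : cf; apply; exact: interval_open.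
Qed.

Lemma measurable_norm : measurable_fun [set: BX] (fun x : BX => `|x : X|).
Proof. by apply: continuous_measurable_real => x; exact: norm_continuous. Qed.

Hypothesis sepX : separable_space X.

Lemma dense_sequence : exists c : nat -> X,
  forall x e, 0 < e -> exists i, `|c i - x| < e.
Proof.
have [D [cD DT]] := sepX.
have [f injf] := countable_injP _ cD.
have [c fc] : {c : nat -> X & forall k y, D y -> f y = k -> c k = y}.
  apply: (@choice _ _ (fun k x => forall y, D y -> f y = k -> x = y)) => k.
  have [[z [Dz fz]]|nz] := pselect (exists z, D z /\ f z = k).
    by exists z => y Dy fy; apply: injf; rewrite ?inE// fz fy.
  by exists 0 => y Dy fy; exfalso; apply: nz; exists y.
exists c => x e e0; have : closure D x by rewrite DT.
move=> /(_ (ball x e)) []; first exact: nbhsx_ballx.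
move=> y [Dy]; rewrite -ball_normE /= => xy; exists (f y).
by rewrite (fc _ _ Dy erefl) distrC.
Qed.

Lemma separable_dist_BX :
  separable_dist (fun x y : BX => `|(x : X) - (y : X)|).
Proof.
split.
- by move=> x y; rewrite distrC.
- by move=> x y z; exact: ler_distD.
- exact: dense_sequence.
- move=> x r; apply: sub_sigma_algebra.
  have [r0|r0] := ltP 0 r.
    have -> : [set y : X | `|(x : X) - y| < r] = ball (x : X) r.
      by rewrite -ball_normE.
    exact: ball_open.
  have -> : [set y : X | `|(x : X) - y| < r] = set0; last exact: open0.
  apply/seteqP; split => // y /=; rewrite ltNge => /negP; apply.
  exact: le_trans r0 _.
Qed.

(** Continuity only gives that the preimage of an open set is open in the product; separability
    places it in the product sigma-algebra. *)
Lemma measurable_add_pair :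
  measurable_fun [set: BX * BX] (fun p => (p.1 : X) + (p.2 : X) : BX).
Proof.
apply: (dist_open_measurable_fun
  (separable_dist_prod separable_dist_BX separable_dist_BX)).
move=> A oA x Ax; have [r r0 rA] := open_normP oA Ax.
exists (r / 2); first by rewrite divr_gt0.
move=> y; rewrite gt_max => /andP[y1 y2]; apply: rA.
rewrite (_ : _ - _ = (x.1 - y.1 : X) + (x.2 - y.2 : X)); last first.
  by rewrite opprD addrACA.
by rewrite (splitr r) (le_lt_trans (ler_normD _ _))// ltrD.
Qed.

Context {d} {T : measurableType d}.
Implicit Types f g : T -> BX.

Lemma measurable_addv f g : measurable_fun setT f -> measurable_fun setT g ->
  measurable_fun setT (fun t => (f t : X) + (g t : X) : BX).
Proof.
move=> mf mg; apply: (measurableT_comp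
  (f := fun p : BX * BX => (p.1 : X) + (p.2 : X) : BX) (g := fun t => (f t, g t))); first exact: measurable_add_pair.
exact: measurable_fun_pair.
Qed.

Lemma measurable_scalev (c : R) f : measurable_fun setT f ->
  measurable_fun setT (fun t => c *: (f t : X) : BX).
Proof.
move=> mf; apply: (measurableT_comp (f := fun x : BX => c *: (x : X) : BX)) => //.
by apply: continuous_measurable_BX; exact: scaler_continuous.
Qed.

Lemma measurable_subv f g : measurable_fun setT f -> measurable_fun setT g ->
  measurable_fun setT (fun t => (f t : X) - (g t : X) : BX).
Proof.
move=> mf mg; rewrite (_ : (fun _ => _) =
  (fun t => (f t : X) + (-1) *: (g t : X))); last first.
  by apply/funext => t; rewrite scaleN1r.
by apply: measurable_addv => //; exact: measurable_scalev.
Qed.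

Lemma measurable_normv f : measurable_fun setT f ->
  measurable_fun setT (fun t => `|f t : X|).
Proof. exact: (measurableT_comp measurable_norm). Qed.

Lemma measurable_sqnormv f : measurable_fun setT f ->
  measurable_fun setT (fun t => `|f t : X| ^+ 2).
Proof. by move=> mf; apply: measurable_funX; exact: measurable_normv. Qed.

End BorelVectorSpace.

(** * Means in a Hilbert space *)

Section RealIntegrable.
Context {R : realType} {d} {T : measurableType d} (P : probability T R).
Implicit Types f g : T -> R.

Definition rintegrable f := P.-integrable setT (EFin \o f).

Lemma ge0_rintegrable f : measurable_fun setT f -> (forall x, 0 <= f x) ->
  (\int[P]_x (f x)%:E < +oo)%E -> rintegrable f.
Proof.
move=> mf f0 fy; apply/integrableP; split; first exact/measurable_EFinP.
rewrite (eq_integral (fun x => (f x)%:E))// => x _ /=.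
by rewrite ger0_norm.
Qed.

Lemma rintegrable_le g f : measurable_fun setT f ->
  (forall x, `|f x| <= g x) -> rintegrable g -> rintegrable f.
Proof.
move=> mf fg; apply: le_integrable => //; first exact/measurable_EFinP.
by move=> x _ /=; rewrite lee_fin (le_trans (fg x))// ler_norm.
Qed.

Lemma rintegrable_cst (c : R) : rintegrable (fun=> c).
Proof.
by apply: finite_measure_integrable_cst.
Qed.

Lemma rintegrableD f g :
  rintegrable f -> rintegrable g -> rintegrable (fun x => f x + g x).
Proof. by move=> rf rg; exact: integrableD rf rg. Qed.

Lemma rintegrableZ (c : R) f : rintegrable f -> rintegrable (fun x => c * f x).
Proof. by move=> rf; exact: integrableZl rf. Qed.

Lemma rintegrableB f g :
  rintegrable f -> rintegrable g -> rintegrable (fun x => f x - g x).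
Proof. by move=> rf rg; exact: integrableB rf rg. Qed.

Lemma EFin_Rintegral f : rintegrable f ->
  ((\int[P]_x f x)%R%:E = \int[P]_x (f x)%:E)%E.
Proof. by move=> rf; rewrite fineK//; exact: integrable_fin_num. Qed.

Lemma RintegralT_cst (c : R) : \int[P]_x c = c.
Proof. by rewrite /Rintegral integral_cst_probability. Qed.

End RealIntegrable.

Section HilbertSpace.
Context {R : realType} {X : completeNormedModType R} {ip : X -> X -> R}.
Hypothesis hip : hilbert_ip R X ip.
Local Notation BX := (BXm R X).

Lemma ipC x y : ip x y = ip y x. Proof. by case: hip. Qed.

Lemma ipxx x : ip x x = `|x| ^+ 2. Proof. by case: hip => _ []. Qed.

Lemma ipDl x y z : ip (x + y) z = ip x z + ip y z.
Proof. by case: hip => _ [+ _] => /(_ 1 x y z); rewrite scale1r mul1r. Qed.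

Lemma ip0l z : ip 0 z = 0.
Proof. by have := ipDl 0 0 z; rewrite addr0; lra. Qed.

Lemma ipZl a x z : ip (a *: x) z = a * ip x z.
Proof. by case: hip => _ [+ _] => /(_ a x 0 z); rewrite !addr0 ip0l addr0. Qed.

Lemma ipNl x z : ip (- x) z = - ip x z.
Proof. by rewrite -scaleN1r ipZl mulN1r. Qed.

Lemma ipBl x y z : ip (x - y) z = ip x z - ip y z.
Proof. by rewrite ipDl ipNl. Qed.

Lemma ipDr x y z : ip z (x + y) = ip z x + ip z y.
Proof. by rewrite ipC ipDl !(ipC z). Qed.

Lemma ipZr a x z : ip z (a *: x) = a * ip z x.
Proof. by rewrite ipC ipZl (ipC z). Qed.

Lemma ipNr x z : ip z (- x) = - ip z x.
Proof. by rewrite ipC ipNl (ipC z). Qed.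

Lemma ipBr x y z : ip z (x - y) = ip z x - ip z y.
Proof. by rewrite ipDr ipNr. Qed.

Lemma sqnormD (x y : X) : `|x + y| ^+ 2 = `|x| ^+ 2 + 2 * ip x y + `|y| ^+ 2.
Proof. by rewrite -!ipxx ipDl !ipDr (ipC y x); lra. Qed.

Lemma sqnormB (x y : X) : `|x - y| ^+ 2 = `|x| ^+ 2 - 2 * ip x y + `|y| ^+ 2.
Proof. by rewrite sqnormD ipNr normrN; lra. Qed.

Lemma normr_ip_le x y : `|ip x y| <= `|x| ^+ 2 + `|y| ^+ 2.
Proof.
have := sqr_ge0 `|x + y|; have := sqr_ge0 `|x - y|.
have := sqr_ge0 `|x|; have := sqr_ge0 `|y|.
rewrite sqnormB sqnormD => *.
by rewrite ler_norml; apply/andP; split; lra.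
Qed.

Lemma sqnormB_le (x y : X) : `|x - y| ^+ 2 <= 2 * `|x| ^+ 2 + 2 * `|y| ^+ 2.
Proof. by have := sqr_ge0 `|x + y|; rewrite sqnormB sqnormD; lra. Qed.

Hypothesis sepX : separable_space X.

Lemma measurable_ip {d} {T : measurableType d} (f g : T -> BX) :
  measurable_fun setT f -> measurable_fun setT g ->
  measurable_fun setT (fun t => ip (f t) (g t)).
Proof.
move=> mf mg.
rewrite (_ : (fun _ => _) = (fun t => 2^-1 *
  (`|(f t : X) + (g t : X)| ^+ 2 - `|f t : X| ^+ 2 - `|g t : X| ^+ 2))).
  apply: measurable_funM => //; apply: measurable_funB.
    apply: measurable_funB; last exact: measurable_sqnormv.
    by apply: measurable_sqnormv; exact: measurable_addv.
  exact: measurable_sqnormv.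
by apply/funext => t; rewrite sqnormD; field.
Qed.

Section FiniteSecondMoment.
Variable k : probability BX R.
Hypothesis k2 : (\int[k]_v (`|v : X| ^+ 2)%:E < +oo)%E.

Let mid : measurable_fun setT (fun v : BX => v). Proof. exact: measurable_id. Qed.

Lemma rintegrable_sqnorm : rintegrable k (fun v : BX => `|v : X| ^+ 2).
Proof.
by apply: ge0_rintegrable => //; exact: measurable_sqnormv.
Qed.

Lemma rintegrable_ip (y : X) : rintegrable k (fun v : BX => ip v y).
Proof.
apply: (@rintegrable_le _ _ _ _ (fun v : BX => `|v : X| ^+ 2 + `|y| ^+ 2)).
- by apply: measurable_ip => //; exact: measurable_cst.
- by move=> v; exact: normr_ip_le.
- by apply: rintegrableD; [exact: rintegrable_sqnorm|exact: rintegrable_cst].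
Qed.

Let expand (w : X) (s : R) (v : BX) :
  `|w + s *: (v : X)| ^+ 2 = `|w| ^+ 2 + 2 * s * ip v w + s ^+ 2 * `|v : X| ^+ 2.
Proof.
by rewrite sqnormD ipZr normrZ exprMn -normrX ger0_norm ?sqr_ge0// (ipC w); lra.
Qed.

Lemma rintegrable_sqnorm_affine (w : X) (s : R) :
  rintegrable k (fun v : BX => `|w + s *: (v : X)| ^+ 2).
Proof.
rewrite (_ : (fun _ => _) = (fun v : BX =>
  `|w| ^+ 2 + 2 * s * ip v w + s ^+ 2 * `|v : X| ^+ 2)); last first.
  by apply/funext => v; exact: expand.
apply: rintegrableD; last by apply: rintegrableZ; exact: rintegrable_sqnorm.
apply: rintegrableD; first exact: rintegrable_cst.
by apply: rintegrableZ; exact: rintegrable_ip.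
Qed.

Lemma Rintegral_sqnorm_affine (w : X) (s : R) :
  \int[k]_v `|w + s *: (v : X)| ^+ 2 =
  `|w| ^+ 2 + 2 * s * (\int[k]_v ip v w) + s ^+ 2 * (\int[k]_v `|v : X| ^+ 2).
Proof.
under eq_Rintegral do rewrite expand.
have r1 := rintegrable_cst k (`|w| ^+ 2).
have r2 := rintegrableZ (2 * s) (rintegrable_ip w).
have r3 := rintegrableZ (s ^+ 2) rintegrable_sqnorm.
rewrite RintegralD//; last exact: rintegrableD.
rewrite RintegralD// RintegralT_cst RintegralZl//; last exact: rintegrable_ip.
by rewrite RintegralZl//; exact: rintegrable_sqnorm.
Qed.

Let phi (z : X) : R := \int[k]_v `|z - (v : X)| ^+ 2.

Let phiE z : phi z = `|z| ^+ 2 - 2 * (\int[k]_v ip v z) + \int[k]_v `|v : X| ^+ 2.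
Proof.
rewrite /phi; under eq_Rintegral do rewrite -scaleN1r.
by rewrite Rintegral_sqnorm_affine; ring.
Qed.

Let ellD y z : \int[k]_v ip v (y + z) = \int[k]_v ip v y + \int[k]_v ip v z.
Proof.
under eq_Rintegral do rewrite ipDr.
by rewrite RintegralD//; exact: rintegrable_ip.
Qed.

Let ellZ a z : \int[k]_v ip v (a *: z) = a * \int[k]_v ip v z.
Proof.
under eq_Rintegral do rewrite ipZr.
by rewrite RintegralZl//; exact: rintegrable_ip.
Qed.

Let phi_ge0 z : 0 <= phi z.
Proof. by apply: Rintegral_ge0 => v _; exact: sqr_ge0. Qed.

(** The constant and linear parts of [phi] cancel in this combination. Points where [phi] is nearly
    minimal are therefore close to each other, so minimising sequences are Cauchy. *)
Let parallelogram y z :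
  `|y - z| ^+ 2 = 2 * phi y + 2 * phi z - 4 * phi (2^-1 *: (y + z)).
Proof.
rewrite !phiE ellZ ellD normrZ exprMn sqnormB sqnormD.
by rewrite ger0_norm//; field.
Qed.

Let phi_minimizer_ip b : (forall z, phi b <= phi z) ->
  forall y, ip b y = \int[k]_v ip v y.
Proof.
move=> bmin y; set q := (RHS).
pose n := `|y| ^+ 2; have n0 : 0 <= n by exact: sqr_ge0.
(* Almost the minimising step along [y], with [n + 1] in place of [n] so that [y = 0] is covered;
   the resulting change of [phi] is [- t ^+ 2 * (n + 2)], which forces [t = 0]. *)
pose t := - ((ip b y - q) / (n + 1)).
have := bmin (b + t *: y).
rewrite !phiE ellD ellZ -/q sqnormD ipZr normrZ exprMn -/n.
rewrite real_normK ?num_real// => h.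
have {h} h : 0 <= t * (2 * (ip b y - q) + t * n) by nra.
have tE : ip b y - q = - t * (n + 1) by rewrite /t; field; rewrite gt_eqF// ltr_wpDl.
move: h; rewrite tE => h; have {h} h : t ^+ 2 * (n + 2) <= 0 by nra.
have t0 : t = 0.
  apply/eqP; rewrite -sqrf_eq0 eq_le sqr_ge0 andbT.
  by have := mulr_ge0 (sqr_ge0 t) n0; lra.
by move: tE; rewrite t0; lra.
Qed.

(** Young's inequality under the integral. It plays the part of continuity of [phi] when passing to
    the limit of a minimising sequence. *)
Let phi_perturb (e : R) b z : 0 < e ->
  phi b <= (1 + e) * phi z + (1 + e^-1) * `|b - z| ^+ 2.
Proof.
move=> e0.
have rz y : rintegrable k (fun v : BX => `|y - (v : X)| ^+ 2).
  rewrite (_ : (fun _ => _) = (fun v : BX => `|y + (-1) *: (v : X)| ^+ 2)).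
    exact: rintegrable_sqnorm_affine.
  by apply/funext => v; rewrite scaleN1r.
have -> : (1 + e) * phi z + (1 + e^-1) * `|b - z| ^+ 2 =
    \int[k]_v ((1 + e) * `|z - (v : X)| ^+ 2 + (1 + e^-1) * `|b - z| ^+ 2).
  rewrite RintegralD//; last 2 first.
  - by apply: rintegrableZ; exact: rz.
  - exact: rintegrable_cst.
  by rewrite RintegralT_cst RintegralZl//; exact: rz.
apply: le_Rintegral => //; first exact: rz.
  apply: rintegrableD; last exact: rintegrable_cst.
  by apply: rintegrableZ; exact: rz.
move=> v _; rewrite (_ : b - _ = (z - (v : X)) + (b - z)); last first.
  by rewrite [RHS]addrC addrA subrK.
rewrite sqnormD.
set p := z - _; set q := b - z.
have := sqr_ge0 `|e *: p - q|; rewrite sqnormB ipZl normrZ exprMn real_normK ?num_real//.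
move=> h; have : 2 * ip p q <= e * `|p| ^+ 2 + e^-1 * `|q| ^+ 2; last by lra.
rewrite -(ler_pM2l e0) mulrDr [e * (e^-1 * _)]mulrA mulfV ?gt_eqF// mul1r.
by nra.
Qed.

(* Riesz representation of the mean functional, obtained by minimising the
   variance [phi]. *)
Lemma exists_mean : exists b : X, forall y, ip b y = \int[k]_v ip v y.
Proof.
pose S := range phi.
have S0 : has_inf S.
  by split; [exists (phi 0), 0|exists 0 => _ [z _ <-]].
pose m := inf S.
have mle z : m <= phi z by apply: ge_inf; [exact: S0.2|exists z].
have [z zm] : {z : nat -> X & forall n, phi (z n) < m + n.+1%:R^-1}.
  apply: (@choice _ _ (fun n x => phi x < m + n.+1%:R^-1)) => n.
  have [//|_ [x _ <-] xm] := @inf_adherent _ S n.+1%:R^-1 _ S0.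
  by exists x.
have zz n p : `|z n - z p| ^+ 2 < 2 * n.+1%:R^-1 + 2 * p.+1%:R^-1.
  have := zm n; have := zm p; have := mle (2^-1 *: (z n + z p)).
  rewrite parallelogram; move: (phi (z n)) (phi (z p)) (phi (2^-1 *: _)).
  by move: (n.+1%:R^-1) (p.+1%:R^-1) => *; lra.
have cz : cvg (z @ \oo).
  apply/cauchy_cvgP/cauchy_ballP => e e0; near_simpl.
  have e2 : 0 < e ^+ 2 / 4 by rewrite divr_gt0// exprn_gt0.
  near=> n p; rewrite -ball_normE /=.
  rewrite -(ltr_pXn2r (n := 2))// ?nnegrE// ?(ltW e0)//.
  apply: lt_trans (zz _ _) _.
  have : n.+1%:R^-1 < e ^+ 2 / 4 by near: n; exact: (near_infty_natSinv_lt (PosNum e2)).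
  have : p.+1%:R^-1 < e ^+ 2 / 4 by near: p; exact: (near_infty_natSinv_lt (PosNum e2)).
  by move: (n.+1%:R^-1) (p.+1%:R^-1) => i j; lra.
pose b := lim (z @ \oo).
exists b; apply: phi_minimizer_ip => y; apply: le_trans (mle y).
apply/ler_addgt0Pr => e e0.
have m0 : 0 <= m by apply: lb_le_inf => [|_ [x _ <-]//]; exact: S0.1.
(* The error budget: [e' * m] takes at most [e / 2], while the excess of [phi (z n)] over [m] and
   the distance from [b] to [z n] take [e / 4] each. The denominator uses [m + 1] because [m] may
   vanish. *)
pose e' := e / (2 * (m + 1)).
have e'0 : 0 < e' by rewrite divr_gt0// mulr_gt0// ltr_wpDl.
have em : e' * m <= e / 2.
  rewrite (_ : e / 2 = e' * (m + 1)); last by rewrite /e'; field; rewrite gt_eqF// ltr_wpDl.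
  by rewrite ler_pM2l// lerDl.
have c1 : 0 < 1 + e' by rewrite addr_gt0.
have c2 : 0 < 1 + e'^-1 by rewrite addr_gt0// invr_gt0.
have d1 : 0 < e / 4 / (1 + e') by rewrite !divr_gt0.
have d2 : 0 < e / 4 / (1 + e'^-1) by rewrite !divr_gt0.
near \oo => n.
apply: le_trans (phi_perturb b (z n) e'0) _.
have h1 : n.+1%:R^-1 < e / 4 / (1 + e').
  by near: n; exact: (near_infty_natSinv_lt (PosNum d1)).
(* A distance below 1 dominates its own square, so a bound on the distance suffices. *)
have h2 : `|b - z n| < Num.min 1 (e / 4 / (1 + e'^-1)).
  near: n; have /cvgrPdist_lt := cz; apply.
  by rewrite lt_min ltr01.
have {}h2 : `|b - z n| ^+ 2 <= e / 4 / (1 + e'^-1).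
  move: h2; rewrite lt_min expr2 => /andP[l1 /ltW l2].
  by apply: le_trans l2; rewrite ler_piMl// ltW.
have {}h1 : (1 + e') * phi (z n) <= (1 + e') * m + e / 4.
  rewrite -lter_pdivlMl// mulrDr mulKf ?gt_eqF// [_^-1 * _]mulrC.
  exact: le_trans (ltW (zm n)) (lerD _ (ltW h1)).
have {}h2 : (1 + e'^-1) * `|b - z n| ^+ 2 <= e / 4.
  by rewrite -lter_pdivlMl// mulrC.
by lra.
Unshelve. all: by end_near. Qed.

End FiniteSecondMoment.
End HilbertSpace.

Section CouplingIntegral.
Context {R : realType} {d1 d2} {T1 : measurableType d1} {T2 : measurableType d2}.
Variables (P1 : probability T1 R) (P2 : probability T2 R).
Variable g : probability (T1 * T2)%type R.
Hypothesis cg : coupling P1 P2 g.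

Lemma coupling_integral_fst (f : T1 -> \bar R) : measurable_fun setT f ->
  (forall x, 0 <= f x)%E -> (\int[g]_p f p.1 = \int[P1]_x f x)%E.
Proof.
move=> mf f0; rewrite -(ge0_integral_pushp g measurable_fst mf f0).
apply: eq_measure_integral => A mA _; rewrite -[RHS](cg.1 _ mA).
by congr (g _); apply/seteqP; split => -[a b] // [].
Qed.

Lemma coupling_integral_snd (f : T2 -> \bar R) : measurable_fun setT f ->
  (forall x, 0 <= f x)%E -> (\int[g]_p f p.2 = \int[P2]_x f x)%E.
Proof.
move=> mf f0; rewrite -(ge0_integral_pushp g measurable_snd mf f0).
apply: eq_measure_integral => A mA _; rewrite -[RHS](cg.2 _ mA).
by congr (g _); apply/seteqP; split => -[a b] // [].
Qed.

End CouplingIntegral.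

(** * Measurable barycenters of kernels *)

Section MeanKernel.
Context {R : realType} {X : completeNormedModType R} {ip : X -> X -> R}.
Hypothesis hip : hilbert_ip R X ip.
Hypothesis sepX : separable_space X.
Local Notation BX := (BXm R X).

(** The squared norm of [w] is the supremum of [2 * ip w c] minus the squared norm of [c], over [c]
    in a dense sequence. Closed balls thus pull back to countable intersections of sets defined by
    scalar functions, and every open set is a countable union of such balls. *)
Lemma weak_measurable {d} {T : measurableType d} (f : T -> BX) :
  (forall y, measurable_fun setT (fun t => ip (f t) y)) -> measurable_fun setT f.
Proof.
move=> mf; have [c dc] := dense_sequence sepX.
have ballE i r : 0 <= r -> [set t | `|(f t : X) - c i| <= r] =
    \bigcap_j [set t | 2 * ip ((f t : X) - c i) (c j) - `|c j| ^+ 2 <= r ^+ 2].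
  move=> r0; apply/seteqP; split => [t /= tr j _ /=|t tr /=].
    have := sqr_ge0 `|(f t : X) - c i - c j|; rewrite (sqnormB hip _ (c j)) => h.
    have : `|(f t : X) - c i| ^+ 2 <= r ^+ 2 by rewrite lerXn2r ?nnegrE.
    by lra.
  rewrite leNgt; apply/negP => rt.
  have e0 : 0 < Num.sqrt (`|(f t : X) - c i| ^+ 2 - r ^+ 2).
    by rewrite sqrtr_gt0 subr_gt0 ltrXn2r// nnegrE.
  have [j cj] := dc ((f t : X) - c i) _ e0.
  have := tr j I; rewrite /= leNgt => /negP; apply.
  move: e0 cj rt; set w := (f t : X) - c i => e0 cj rt.
  have : `|c j - w| ^+ 2 < `|w| ^+ 2 - r ^+ 2.
    rewrite -[ltRHS]sqr_sqrtr; first by rewrite ltrXn2r// nnegrE ltW.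
    by rewrite subr_ge0 lerXn2r ?nnegrE// ltW.
  by rewrite distrC (sqnormB hip w); lra.
have mball i r : 0 <= r -> measurable [set t | `|(f t : X) - c i| <= r].
  move=> r0; rewrite ballE//; apply: bigcapT_measurable => j.
  have mh : measurable_fun setT
      (fun t => 2 * ip ((f t : X) - c i) (c j) - `|c j| ^+ 2).
    apply: measurable_funB => //; apply: measurable_funM => //.
    under eq_fun do rewrite (ipBl hip).
    by apply: measurable_funB.
  have := mh measurableT _ (measurable_itv `]-oo, (r ^+ 2)]); rewrite setTI.
  by congr measurable; apply/seteqP; split => t /=; rewrite in_itv.
apply: (@measurability _ _ T BX setT f (@open X)) => //.
move=> _ [A oA <-]; rewrite setTI.
pose B i n := [set y : X | `|y - c i| <= n.+1%:R^-1].
pose F i n := if pselect (B i n `<=` A) then f @^-1` B i n else set0.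
rewrite (_ : f @^-1` A = \bigcup_i \bigcup_n F i n); last first.
  apply/seteqP; split => [t At|t [i _ [n _]]]; last first.
    by rewrite /F; case: pselect => // BA /BA.
  have [r r0 rA] := open_normP oA At.
  have /ltr_add_invr[n] : 0 < r / 2 by rewrite divr_gt0.
  rewrite add0r => nr; have [//|i ci] := dc (f t) n.+1%:R^-1.
  exists i => //; exists n => //; rewrite /F; case: pselect => //= [_|[] y /= By].
    by rewrite /B /= distrC ltW.
  apply: rA; rewrite -(subrKA (c i)) (le_lt_trans (ler_normD _ _))//.
  rewrite (splitr r) ltrD//; first by rewrite distrC (lt_trans ci).
  by rewrite distrC (le_lt_trans By).
apply: bigcupT_measurable => i; apply: bigcupT_measurable => n.
by rewrite /F; case: pselect => ? /=; [exact: mball|exact: measurable0].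
Qed.

Definition sqmean (k : probability BX R) : \bar R :=
  (\int[k]_v (`|v : X| ^+ 2)%:E)%E.

Lemma sqmean_ge0 k : (0 <= sqmean k)%E.
Proof. by apply: integral_ge0 => v _; rewrite lee_fin sqr_ge0. Qed.

(** The difference of the two sides is the variance of [k]. *)
Lemma mean_sqnorm_le (k : probability BX R) (b : X) : (sqmean k < +oo)%E ->
  (forall y, ip b y = \int[k]_v ip v y) -> `|b| ^+ 2 <= fine (sqmean k).
Proof.
move=> k2 bE; have := Rintegral_sqnorm_affine hip sepX k2 b (-1).
rewrite -bE (ipxx hip) => h.
have : 0 <= \int[k]_v `|b + (-1) *: (v : X)| ^+ 2.
  by apply: Rintegral_ge0 => v _; exact: sqr_ge0.
by rewrite h /sqmean /Rintegral; lra.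
Qed.

(** The means are chosen pointwise, so measurability has to be recovered afterwards. Where the
    second moment is infinite the value is 0, which agrees with [fine +oo = 0] and makes the norm
    bound hold at every point. *)
Lemma exists_mean_kernel {d} {T : measurableType d} (K : T -> probability BX R) :
  (forall B, measurable B -> measurable_fun setT (K ^~ B)) ->
  exists b : T -> BX, [/\ measurable_fun setT b,
    (forall x, `|b x : X| ^+ 2 <= fine (sqmean (K x))) &
    forall x, (sqmean (K x) < +oo)%E -> forall y, ip (b x) y = \int[K x]_v ip v y].
Proof.
move=> mK.
have [b bP] : {b : T -> X & forall x,
    ((sqmean (K x) < +oo)%E -> forall y, ip (b x) y = \int[K x]_v ip v y) /\
    (~ (sqmean (K x) < +oo)%E -> b x = 0)}.
  apply: (@choice _ _ (fun x z =>
    ((sqmean (K x) < +oo)%E -> forall y, ip z y = \int[K x]_v ip v y) /\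
    (~ (sqmean (K x) < +oo)%E -> z = 0))) => x.
  have [fx|nfx] := pselect (sqmean (K x) < +oo)%E; last by exists 0; split.
  by have [z zP] := exists_mean hip sepX fx; exists z; split.
exists b; split => [|x|x fx]; last exact: (bP x).1.
- have msq (y : X) : measurable_fun setT
      (fun x => \int[K x]_v (`|y - (v : X)| ^+ 2)%:E)%E.
    apply: measurable_fun_integral_kernel => [U mU|v|]; first exact: mK.
      by rewrite lee_fin sqr_ge0.
    apply/measurable_EFinP; apply: measurable_sqnormv.
    by apply: measurable_subv => //; exact: measurable_cst.
  have msqm : measurable_fun setT (fun x => sqmean (K x)).
    have := msq 0; congr measurable_fun; apply/funext => x.
    by apply: eq_integral => v _; rewrite sub0r normrN.
  have fineT : measurable_fun setT (@fine R) by exact: fine_measurable.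
  apply: weak_measurable => y.
  (* Polarization writes the pairing of the mean with [y] through integrals of nonnegative functions
     against [K x], which are measurable in [x]. *)
  rewrite (_ : (fun _ => _) = (fun x => if (sqmean (K x) < +oo)%E then
      2^-1 * (`|y| ^+ 2 + fine (sqmean (K x)) -
              fine (\int[K x]_v (`|y - (v : X)| ^+ 2)%:E)%E) else 0)).
    apply: measurable_fun_ifT => //.
      apply: (@measurable_fun_bool _ _ _ _ true) => /=.
      have := emeasurable_fun_infty_o measurableT msqm +oo%E.
      by rewrite !setTI.
    apply: measurable_funM => //; apply: measurable_funB.
      by apply: measurable_funD => //; exact: (measurableT_comp fineT msqm).
    exact: (measurableT_comp fineT (msq y)).
  apply/funext => x; case: ifPn => [fx|/negP nfx]; last first.
    by rewrite (bP x).2// (ip0l hip).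
  have := Rintegral_sqnorm_affine hip sepX fx y (-1).
  rewrite -(bP x).1// /Rintegral /sqmean.
  under eq_integral do rewrite scaleN1r.
  by move=> ->; lra.
- have [fx|nfx] := pselect (sqmean (K x) < +oo)%E.
    by apply: mean_sqnorm_le => //; exact: (bP x).1.
  by rewrite (bP x).2// normr0 expr0n fine_ge0// sqmean_ge0.
Qed.

Section TwoMeasures.
Variables (k1 k2 : probability BX R) (b1 b2 : X).
Hypotheses (f1 : (sqmean k1 < +oo)%E) (f2 : (sqmean k2 < +oo)%E).
Hypotheses (b1E : forall y, ip b1 y = \int[k1]_v ip v y)
           (b2E : forall y, ip b2 y = \int[k2]_v ip v y).

Let c1 := fine (sqmean k1).
Let c2 := fine (sqmean k2).

(** The two velocities are independent under the iterated integral, so all cross terms factor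
    through the means. *)
Lemma integral_sqnorm_diff (z : X) (s : R) :
  (\int[k1]_v \int[k2]_w (`|z + s *: ((v : X) - (w : X))| ^+ 2)%:E =
   (`|z| ^+ 2 + 2 * s * ip z (b1 - b2) +
    s ^+ 2 * (c1 - 2 * ip b1 b2 + c2))%:E)%E.
Proof.
transitivity (\int[k1]_v ((`|z + s *: (v : X)| ^+ 2 +
    (s ^+ 2 * c2 - 2 * s * ip z b2 - 2 * s ^+ 2 * ip v b2))%:E))%E.
  apply: eq_integral => v _.
  under eq_integral do rewrite scalerBr addrA -scaleNr.
  have := rintegrable_sqnorm_affine hip sepX f2 (z + s *: (v : X)) (- s).
  move=> /EFin_Rintegral <-.
  rewrite (Rintegral_sqnorm_affine hip sepX f2) -b2E (ipDr hip) (ipZr hip).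
  rewrite -/c2 (ipC hip b2 z) (ipC hip b2 v) -[in RHS]/c2 /c2 /sqmean /Rintegral.
  by congr EFin; ring.
have r1 := rintegrable_sqnorm_affine hip sepX f1 z s.
have r2 := rintegrableZ (2 * s ^+ 2) (rintegrable_ip hip sepX f1 b2).
have r3 := rintegrable_cst k1 (s ^+ 2 * c2 - 2 * s * ip z b2).
have r4 := rintegrableB r3 r2.
rewrite -EFin_Rintegral; last exact: rintegrableD r1 r4.
rewrite RintegralD// RintegralB// RintegralT_cst RintegralZl//; last first.
  exact: rintegrable_ip.
rewrite -b1E (Rintegral_sqnorm_affine hip sepX f1) -b1E.
rewrite (ipBr hip) (ipC hip b1 z) /c1 /sqmean /Rintegral.
by congr EFin; ring.
Qed.

Let b1c : `|b1| ^+ 2 <= c1. Proof. exact: mean_sqnorm_le. Qed.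
Let b2c : `|b2| ^+ 2 <= c2. Proof. exact: mean_sqnorm_le. Qed.

(** The term [- 2 * ip b1 b2] is at most the sum of the squared norms of the means, hence at most
    [c1 + c2]. *)
Lemma integral_sqnorm_diff_le (z : X) (s : R) :
  (\int[k1]_v \int[k2]_w (`|z + s *: ((v : X) - (w : X))| ^+ 2)%:E <=
   (`|z| ^+ 2 + 2 * s * ip z (b1 - b2) + s ^+ 2 * (2 * c1 + 2 * c2))%:E)%E.
Proof.
rewrite integral_sqnorm_diff lee_fin lerD2l ler_wpM2l ?sqr_ge0//.
by have := sqr_ge0 `|b1 + b2|; rewrite (sqnormD hip); move: b1c b2c; lra.
Qed.

End TwoMeasures.
End MeanKernel.

(** * Velocity kernels *)

Section VelocityKernel.
Context {R : realType} {X : completeNormedModType R} {ip : X -> X -> R}.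
Hypothesis hip : hilbert_ip R X ip.
Hypothesis sepX : separable_space X.
Local Notation BX := (BXm R X).
Local Notation TX := (TX R X).

Lemma measurable_expt (tau : R) :
  measurable_fun setT (fun p : TX => (expt R X tau p : BX)).
Proof.
apply: (measurable_addv sepX (f := fst) (g := fun p : TX => tau *: (p.2 : X))) => //.
by apply: measurable_scalev; exact: measurable_snd.
Qed.

Lemma measurable_velocity_pair (tau : R) : measurable_fun setT
  (fun p : BX * BX => tau^-1 *: ((p.2 : X) - (p.1 : X)) : BX).
Proof.
apply: (measurable_scalev _ (f := fun p : BX * BX => (p.2 : X) - (p.1 : X) : BX)).
exact: measurable_subv.
Qed.

(** The scheme supplies kernels between positions, whereas barycenters are those of velocities. For
    fixed [x] the map from [v] to [x + tau *: v] is invertible, so [V x] is the image of [K x] under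
    its inverse. *)
Lemma exists_velocity_kernel (tau : R) (Phi : probability TX R)
    (M : probability BX R) (K : BX -> probability BX R) : 0 < tau ->
  disintegrates (step_plan R X tau Phi) M K ->
  exists V : BX -> probability BX R, disintegrates Phi M V /\
    forall x (f : BX -> \bar R), (forall y, 0 <= f y)%E ->
      measurable_fun setT f ->
      (\int[K x]_y f y = \int[V x]_v f (((x : X) + tau *: (v : X))%R : BX))%E.
Proof.
move=> tau0 dK; have mK := dK.1.
have mvel x : measurable_fun setT
    (fun y : BX => tau^-1 *: ((y : X) - (x : X)) : BX).
  apply: measurable_scalev.
  by apply: measurable_subv; [|exact: measurable_id|exact: measurable_cst].
pose V x := pushp (K x) (mvel x).
have mst : measurable_fun setT (fun p : TX => ((p.1, expt R X tau p) : BX * BX)).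
  by apply: measurable_fun_pair => //; exact: measurable_expt.
(* The event that the position lies in [A] and the velocity in [B], seen in pairs of positions. Its
   section at [x] has [K x]-mass [V x B] if [x] is in [A], and is empty otherwise. *)
pose E (A B : set BX) :=
  [set p : BX * BX | A p.1 /\ B (tau^-1 *: ((p.2 : X) - (p.1 : X)))].
have mE A B : measurable A -> measurable B -> measurable (E A B).
  move=> mA mB.
  have := measurable_velocity_pair tau measurableT mB; rewrite setTI => mB'.
  have := measurable_fst (T1 := BX) (T2 := BX) measurableT _ mA; rewrite setTI => mA'.
  exact: measurableI.
exists V; split; first split.
- move=> B mB.
  have := measurable_kernel_xsection mK (mE _ _ measurableT mB).
  congr measurable_fun; apply/funext => x; rewrite xsectionE.
  by congr (K x _); apply/seteqP; split => y // [].
- move=> A B mA mB.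
  have dK' : disintegrates (pushp Phi mst) M K := dK.
  have := disintegrates_semid mK dK' (mE _ _ mA mB).
  rewrite semidE => h.
  transitivity (Phi ((fun p : TX => ((p.1, expt R X tau p) : BX * BX)) @^-1` E A B)).
    congr (Phi _); apply/seteqP; split => -[x v] /=;
      by rewrite /E /expt /= addrAC subrr add0r scalerA mulVf ?gt_eqF// scale1r.
  rewrite [LHS]h [RHS]integral_mkcond; apply: eq_integral => x _.
  rewrite patchE xsectionE; case: ifPn => xA.
    congr (K x _); apply/seteqP; split => y /=; first by case.
    by split => //; rewrite inE in xA.
  rewrite (_ : _ @^-1` _ = set0) ?measure0//.
  by apply/seteqP; split => y //= [] /mem_set; rewrite (negbTE xA).
- move=> x f f0 mf; rewrite /V ge0_integral_pushp//.
    apply: eq_integral => y _; congr f.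
    by rewrite scalerA mulfV ?gt_eqF// scale1r addrC subrK.
  apply: (measurableT_comp mf); apply: measurable_addv => //.
  by apply: measurable_scalev; exact: measurable_id.
Qed.

Lemma disintegrates_integral (Phi : probability TX R) (M : probability BX R)
    (V : BX -> probability BX R) (f : BX -> \bar R) :
  disintegrates Phi M V -> (forall y, 0 <= f y)%E -> measurable_fun setT f ->
  (\int[M]_x \int[V x]_v f v = \int[Phi]_p f p.2)%E.
Proof.
move=> dV f0 mf; have mV := dV.1.
have mf2 : measurable_fun setT (fun p : BX * BX => f p.2) by exact: measurableT_comp.
rewrite -(ge0_integral_semid M mV (f := fun p => f p.2))//.
apply: eq_measure_integral => E mE _.
by rewrite [RHS](disintegrates_semid mV dV mE).
Qed.

Definition mean_of (V : BX -> probability BX R) (b : BX -> BX) :=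
  [/\ measurable_fun setT b,
    (forall x, `|b x : X| ^+ 2 <= fine (sqmean (V x))) &
    forall x, (sqmean (V x) < +oo)%E -> forall y, ip (b x) y = \int[V x]_v ip v y].

Lemma measurable_sqmean (V : BX -> probability BX R) :
  (forall B, measurable B -> measurable_fun setT (V ^~ B)) ->
  measurable_fun setT (fun x => sqmean (V x)).
Proof.
move=> mV; apply: measurable_fun_integral_kernel => [U mU|v|]; first exact: mV.
  by rewrite lee_fin sqr_ge0.
by apply/measurable_EFinP; exact: measurable_sqnormv.
Qed.

(** A finite second moment of [Phi] makes the second moment of [V x] finite for almost every [x]; on
    the exceptional null set the default value of [b] is harmless. *)
Lemma mean_barycenter (Phi : probability TX R) (M : probability BX R)
    (V : BX -> probability BX R) (b : BX -> BX) :
  marg1 Phi M -> disintegrates Phi M V -> mean_of V b ->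
  (\int[Phi]_p (`|p.2 : X| ^+ 2)%:E < +oo)%E -> barycenter R X ip Phi M b.
Proof.
move=> mPhi dV [mb _ bE] f2; split => //; split => //; exists V; split => //.
have : M.-integrable setT (fun x => sqmean (V x)).
  apply/integrableP; split; first by apply: measurable_sqmean; exact: dV.1.
  under eq_integral do rewrite gee0_abs ?sqmean_ge0//.
  rewrite /sqmean (disintegrates_integral dV (f := fun v : BX => (`|v : X| ^+ 2)%:E))//.
    by apply/measurable_EFinP; exact: measurable_sqnormv.
move=> /integrable_ae => /(_ measurableT); apply: filterS => x /(_ I) fx y.
have {}fx : (sqmean (V x) < +oo)%E by rewrite ltey_eq fx.
by rewrite bE// EFin_Rintegral//; exact: rintegrable_ip.
Qed.

End VelocityKernel.

(** * One step of the scheme *)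

Section OneStep.
Context {R : realType} {X : completeNormedModType R} {ip : X -> X -> R}.
Hypothesis hip : hilbert_ip R X ip.
Hypothesis sepX : separable_space X.
Local Notation BX := (BXm R X).
Local Notation TX := (TX R X).
Variables (F : set (probability TX R)) (lam L : R).
Hypothesis diss : tot_dissipative R X ip lam (bar_field R X ip F).

Record step_data (Phi : probability TX R) (M : probability BX R)
    (V : BX -> probability BX R) (b : BX -> BX) : Prop := {
  sd_field : F Phi;
  sd_marg : marg1 Phi M;
  sd_disint : disintegrates Phi M V;
  sd_mean : mean_of (ip := ip) V b;
  sd_speed : (\int[Phi]_p (`|p.2 : X| ^+ 2)%:E <= (L ^+ 2)%:E)%E }.

Section StepData.
Variables (Phi : probability TX R) (M : probability BX R).
Variables (V : BX -> probability BX R) (b : BX -> BX).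
Hypothesis D : step_data Phi M V b.

Lemma sd_measurable_kernel B : measurable B -> measurable_fun setT (V ^~ B).
Proof. exact: (sd_disint D).1. Qed.

Lemma sd_measurable_mean : measurable_fun setT b.
Proof. by case: (sd_mean D). Qed.

Lemma sd_sqmean : (\int[M]_x sqmean (V x) <= (L ^+ 2)%:E)%E.
Proof.
rewrite (disintegrates_integral (sd_disint D)
  (f := fun v : BX => (`|v : X| ^+ 2)%:E)); first exact: (sd_speed D).
  by move=> v; rewrite lee_fin sqr_ge0.
by apply/measurable_EFinP; exact: measurable_sqnormv.
Qed.

(** Passing to [fine] allows computation in the reals; replacing [+oo] by 0 can only lower the
    integral. *)
Lemma sd_fine_sqmean : (\int[M]_x (fine (sqmean (V x)))%:E <= (L ^+ 2)%:E)%E.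
Proof.
apply: le_trans sd_sqmean; apply: ge0_le_integral => //.
- by move=> x _; rewrite lee_fin fine_ge0 ?sqmean_ge0.
- apply/measurable_EFinP; apply: measurableT_comp; first exact: fine_measurable.
  by apply: measurable_sqmean => B; exact: sd_measurable_kernel.
- by apply: measurable_sqmean => B; exact: sd_measurable_kernel.
- move=> x _; have := sqmean_ge0 (V x).
  by case: (sqmean (V x)) => //= ?; rewrite leey.
Qed.

Let mgraph : measurable_fun setT (fun x : BX => ((x, b x) : TX)).
Proof. by apply: measurable_fun_pair => //; exact: sd_measurable_mean. Qed.

Lemma sd_bar_field : bar_field R X ip F (pushp M mgraph).
Proof.
exists Phi, M, b; split; first exact: (sd_field D).
split => //; apply: (mean_barycenter hip sepX (sd_marg D) (sd_disint D)).
  exact: (sd_mean D).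
exact: le_lt_trans (sd_speed D) (ltry _).
Qed.

End StepData.

Variables (Phi1 Phi2 : probability TX R) (M1 M2 : probability BX R).
Variables (V1 V2 : BX -> probability BX R) (b1 b2 : BX -> BX).
Hypotheses (D1 : step_data Phi1 M1 V1 b1) (D2 : step_data Phi2 M2 V2 b2).
Variable g : probability (BX * BX)%type R.
Hypothesis cg : coupling M1 M2 g.

Let c1 (p : BX * BX) := fine (sqmean (V1 p.1)).
Let c2 (p : BX * BX) := fine (sqmean (V2 p.2)).
Let beta (p : BX * BX) : BX := (b1 p.1 : X) - (b2 p.2 : X).
Let delta (p : BX * BX) : BX := (p.1 : X) - (p.2 : X).

Let mc1 : measurable_fun setT c1.
Proof.
apply: measurableT_comp; first exact: fine_measurable.
apply: (measurableT_comp (f := fun x => sqmean (V1 x))) => //.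
by apply: measurable_sqmean => B; exact: (sd_measurable_kernel D1).
Qed.

Let mc2 : measurable_fun setT c2.
Proof.
apply: measurableT_comp; first exact: fine_measurable.
apply: (measurableT_comp (f := fun x => sqmean (V2 x))) => //.
by apply: measurable_sqmean => B; exact: (sd_measurable_kernel D2).
Qed.

Let mbeta : measurable_fun setT beta.
Proof.
apply: measurable_subv => //.
  exact: (measurableT_comp (sd_measurable_mean D1)).
exact: (measurableT_comp (sd_measurable_mean D2)).
Qed.

Let mdelta : measurable_fun setT delta.
Proof. exact: measurable_subv. Qed.

Let c1_ge0 p : 0 <= c1 p. Proof. by rewrite fine_ge0// sqmean_ge0. Qed.
Let c2_ge0 p : 0 <= c2 p. Proof. by rewrite fine_ge0// sqmean_ge0. Qed.

Let c1_int : (\int[g]_p (c1 p)%:E <= (L ^+ 2)%:E)%E.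
Proof.
rewrite (coupling_integral_fst cg (f := fun x => (fine (sqmean (V1 x)))%:E)).
- exact: sd_fine_sqmean D1.
- apply/measurable_EFinP; apply: measurableT_comp; first exact: fine_measurable.
  by apply: measurable_sqmean => B; exact: (sd_measurable_kernel D1).
- by move=> x; rewrite lee_fin fine_ge0// sqmean_ge0.
Qed.

Let c2_int : (\int[g]_p (c2 p)%:E <= (L ^+ 2)%:E)%E.
Proof.
rewrite (coupling_integral_snd cg (f := fun x => (fine (sqmean (V2 x)))%:E)).
- exact: sd_fine_sqmean D2.
- apply/measurable_EFinP; apply: measurableT_comp; first exact: fine_measurable.
  by apply: measurable_sqmean => B; exact: (sd_measurable_kernel D2).
- by move=> x; rewrite lee_fin fine_ge0// sqmean_ge0.
Qed.

Let rc1 : rintegrable g c1.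
Proof. by apply: ge0_rintegrable => //; exact: le_lt_trans c1_int (ltry _). Qed.

Let rc2 : rintegrable g c2.
Proof. by apply: ge0_rintegrable => //; exact: le_lt_trans c2_int (ltry _). Qed.

Let beta_le p : `|beta p : X| ^+ 2 <= 2 * c1 p + 2 * c2 p.
Proof.
apply: le_trans (sqnormB_le hip _ _) _.
have [_ l1 _] := sd_mean D1; have [_ l2 _] := sd_mean D2.
by have := l1 p.1; have := l2 p.2; rewrite /c1 /c2; lra.
Qed.

(** The upper bound of [integral_sqnorm_diff_le] for the conditional mean square of [z p] plus [s]
    times the velocity difference, with means and second moments taken at the positions [p]. *)
Let H (z : BX * BX -> BX) (s : R) p : R :=
  `|z p : X| ^+ 2 + 2 * s * ip (z p) (beta p) + s ^+ 2 * (2 * c1 p + 2 * c2 p).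

Let H_ge0 z s p : 0 <= H z s p.
Proof.
have := sqr_ge0 `|(z p : X) + s *: (beta p : X)|.
rewrite (sqnormD hip) (ipZr hip) normrZ exprMn real_normK ?num_real//.
move=> /le_trans; apply; rewrite /H mulrA.
by rewrite lerD2l ler_wpM2l ?sqr_ge0// beta_le.
Qed.

Let mH z s : measurable_fun setT z -> measurable_fun setT (H z s).
Proof.
move=> mz; apply: measurable_funD.
  apply: measurable_funD; first exact: measurable_sqnormv.
  by apply: measurable_funM => //; exact: (measurable_ip hip).
apply: measurable_funM => //.
by apply: measurable_funD; exact: measurable_funM.
Qed.

(** The pointwise bound needs finite second moments at both positions, which holds almost
    everywhere. The choice [z = 0], [s = 1] yields the speed estimate; the position difference with
    [s = tau] yields the distance estimate. *)
Lemma step_integral_le (z : BX * BX -> BX) (s : R) : measurable_fun setT z ->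
  (\int[g]_p \int[V1 p.1]_v \int[V2 p.2]_w
     (`|(z p : X) + s *: ((v : X) - (w : X))| ^+ 2)%:E <=
   \int[g]_p (H z s p)%:E)%E.
Proof.
move=> mz; apply: ae_ge0_le_integral => //.
- move=> p _; apply: integral_ge0 => v _; apply: integral_ge0 => w _.
  by rewrite lee_fin sqr_ge0.
- pose f (q : (BX * BX) * (BX * BX)) : \bar R :=
    (`|(z (q.1.1, q.2.1) : X) + s *: ((q.1.2 : X) - (q.2.2 : X))| ^+ 2)%:E.
  have f0 q : (0 <= f q)%E by rewrite lee_fin sqr_ge0.
  have mf : measurable_fun setT f.
    apply/measurable_EFinP; apply: measurable_sqnormv; apply: measurable_addv => //.
      apply: (measurableT_comp (f := z) (g := fun q : (BX * BX) * (BX * BX) =>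
        (q.1.1, q.2.1))) => //.
      by apply: measurable_fun_pair; exact: measurableT_comp.
    apply: measurable_scalev; apply: measurable_subv => //.
      exact: (measurableT_comp (f := snd) (g := fst)).
    exact: (measurableT_comp (f := snd) (g := snd)).
  have := measurable_joint_inner (sd_measurable_kernel D1)
    (sd_measurable_kernel D2) f0 mf.
  by congr measurable_fun; apply/funext => -[x y].
- by move=> p _; rewrite lee_fin.
- by apply/measurable_EFinP; exact: mH.
have good1 : {ae g, forall p, (sqmean (V1 p.1) < +oo)%E}.
  have : g.-integrable setT (fun p => sqmean (V1 p.1)).
    have ms := measurable_sqmean (sd_measurable_kernel D1).
    apply/integrableP; split; first exact: (measurableT_comp ms measurable_fst).
    under eq_integral do rewrite gee0_abs ?sqmean_ge0//.
    rewrite (coupling_integral_fst cg ms) => [|x]; last exact: sqmean_ge0.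
    exact: le_lt_trans (sd_sqmean D1) (ltry _).
  move=> /integrable_ae => /(_ measurableT); apply: filterS => p /(_ I) fp.
  by rewrite ltey_eq fp.
have good2 : {ae g, forall p, (sqmean (V2 p.2) < +oo)%E}.
  have : g.-integrable setT (fun p => sqmean (V2 p.2)).
    have ms := measurable_sqmean (sd_measurable_kernel D2).
    apply/integrableP; split; first exact: (measurableT_comp ms measurable_snd).
    under eq_integral do rewrite gee0_abs ?sqmean_ge0//.
    rewrite (coupling_integral_snd cg ms) => [|x]; last exact: sqmean_ge0.
    exact: le_lt_trans (sd_sqmean D2) (ltry _).
  move=> /integrable_ae => /(_ measurableT); apply: filterS => p /(_ I) fp.
  by rewrite ltey_eq fp.
apply: filterS2 good1 good2 => p g1 g2 _.
have [_ _ m1] := sd_mean D1; have [_ _ m2] := sd_mean D2.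
exact: (integral_sqnorm_diff_le hip sepX g1 g2 (m1 _ g1) (m2 _ g2)).
Qed.

Let Rc1 : \int[g]_p c1 p <= L ^+ 2.
Proof. by rewrite -lee_fin EFin_Rintegral. Qed.

Let Rc2 : \int[g]_p c2 p <= L ^+ 2.
Proof. by rewrite -lee_fin EFin_Rintegral. Qed.

Let rc12 : rintegrable g (fun p => 2 * c1 p + 2 * c2 p).
Proof. by apply: rintegrableD; exact: rintegrableZ. Qed.

Let Rc12 : \int[g]_p (2 * c1 p + 2 * c2 p) <= 4 * L ^+ 2.
Proof.
have r1 := rintegrableZ 2 rc1; have r2 := rintegrableZ 2 rc2.
by rewrite RintegralD// !RintegralZl//; move: Rc1 Rc2; lra.
Qed.

Lemma step_speed_le : (\int[g]_p \int[V1 p.1]_v \int[V2 p.2]_w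
  (`|(v : X) - (w : X)| ^+ 2)%:E <= (4 * L ^+ 2)%:E)%E.
Proof.
have -> : (\int[g]_p \int[V1 p.1]_v \int[V2 p.2]_w
      (`|(v : X) - (w : X)| ^+ 2)%:E = \int[g]_p \int[V1 p.1]_v \int[V2 p.2]_w
      (`|0 + 1 *: ((v : X) - (w : X))| ^+ 2)%:E)%E.
  apply: eq_integral => p _; apply: eq_integral => v _; apply: eq_integral => w _.
  by rewrite add0r scale1r.
apply: le_trans (step_integral_le 1 (measurable_cst (0 : BX))) _.
rewrite (eq_integral (fun p => (2 * c1 p + 2 * c2 p)%:E)); last first.
  by move=> p _; rewrite /H /= (ip0l hip) normr0; congr EFin; ring.
by rewrite -EFin_Rintegral// lee_fin.
Qed.

Let mg1 : measurable_fun setT (fun x : BX => ((x, b1 x) : TX)).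
Proof. by apply: measurable_fun_pair => //; exact: (sd_measurable_mean D1). Qed.

Let mg2 : measurable_fun setT (fun x : BX => ((x, b2 x) : TX)).
Proof. by apply: measurable_fun_pair => //; exact: (sd_measurable_mean D2). Qed.

Let mgg : measurable_fun setT (fun p : BX * BX =>
  (((p.1, b1 p.1) : TX), ((p.2, b2 p.2) : TX))).
Proof.
apply: measurable_fun_pair.
  exact: (measurableT_comp mg1 measurable_fst).
exact: (measurableT_comp mg2 measurable_snd).
Qed.

Hypothesis dfin : (\int[g]_p (`|(p.1 : X) - (p.2 : X)| ^+ 2)%:E < +oo)%E.

Let rdelta : rintegrable g (fun p => `|delta p : X| ^+ 2).
Proof.
by apply: ge0_rintegrable => //; exact: measurable_sqnormv.
Qed.

Let rip : rintegrable g (fun p => ip (delta p) (beta p)).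
Proof.
apply: (@rintegrable_le _ _ _ _ (fun p => `|delta p : X| ^+ 2 +
  (2 * c1 p + 2 * c2 p))).
- exact: (measurable_ip hip).
- move=> p; apply: le_trans (normr_ip_le hip _ _) _.
  by rewrite lerD2l.
- exact: rintegrableD rdelta rc12.
Qed.

(** A coupling of positions lifts to one of the two elements of the barycentric field, by pushing it
    through the graphs of [b1] and [b2]; dissipativity is applied to this lift. *)
Lemma mean_dissipative :
  \int[g]_p ip (delta p) (beta p) <= lam * \int[g]_p `|delta p : X| ^+ 2.
Proof.
have cth : coupling (pushp M1 mg1) (pushp M2 mg2) (pushp g mgg).
  split => A mA.
    by have := cg.1 _ (mg1 measurableT mA); rewrite setTI.
  by have := cg.2 _ (mg2 measurableT mA); rewrite setTI.
have := diss (sd_bar_field D1) (sd_bar_field D2) cth.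
have m11 : measurable_fun setT (fun q : TX * TX => q.1.1 : BX).
  exact: (measurableT_comp (f := fst) (g := fst)).
have m12 : measurable_fun setT (fun q : TX * TX => q.1.2 : BX).
  exact: (measurableT_comp (f := snd) (g := fst)).
have m21 : measurable_fun setT (fun q : TX * TX => q.2.1 : BX).
  exact: (measurableT_comp (f := fst) (g := snd)).
have m22 : measurable_fun setT (fun q : TX * TX => q.2.2 : BX).
  exact: (measurableT_comp (f := snd) (g := snd)).
have ipE p : ip ((b2 p.2 : X) - (b1 p.1 : X)) ((p.2 : X) - (p.1 : X)) =
    ip (delta p) (beta p).
  by rewrite -opprB (ipNl hip) -(opprB (p.1 : X)) (ipNr hip) opprK (ipC hip).
rewrite integral_pushp; last 2 first.
- apply/measurable_EFinP; apply: (measurable_ip hip) => //; exact: measurable_subv.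
- by apply: eq_integrable rip => // p _ /=; rewrite ipE.
rewrite [X in (_ <= _ * X)%E]ge0_integral_pushp; last 2 first.
- apply/measurable_EFinP; apply: (measurable_sqnormv
    (f := fun q : TX * TX => (q.2.1 : X) - (q.1.1 : X) : BX)).
  exact: measurable_subv.
- by move=> q; rewrite lee_fin sqr_ge0.
rewrite /=; under eq_integral do rewrite ipE.
under [X in (_ <= _ * X)%E]eq_integral do rewrite distrC.
by rewrite -(EFin_Rintegral rip) -(EFin_Rintegral rdelta) -EFinM lee_fin.
Qed.

Lemma step_dist_le (tau : R) : 0 < tau ->
  (\int[g]_p \int[V1 p.1]_v \int[V2 p.2]_w
     (`|((p.1 : X) - (p.2 : X)) + tau *: ((v : X) - (w : X))| ^+ 2)%:E <=
   (1 + 2 * Num.max lam 0 * tau)%:E *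
     \int[g]_p (`|(p.1 : X) - (p.2 : X)| ^+ 2)%:E + (4 * L ^+ 2 * tau ^+ 2)%:E)%E.
Proof.
move=> tau0; apply: le_trans (step_integral_le tau mdelta) _.
have r1 := rintegrableZ (2 * tau) rip.
have r2 := rintegrableZ (tau ^+ 2) rc12.
have r3 := rintegrableD rdelta r1.
rewrite -EFin_Rintegral; last exact: rintegrableD r3 r2.
rewrite -(EFin_Rintegral rdelta) -EFinM -EFinD lee_fin.
rewrite RintegralD// RintegralD// !RintegralZl//.
have A0 : 0 <= \int[g]_p `|delta p : X| ^+ 2.
  by apply: Rintegral_ge0 => p _; exact: sqr_ge0.
have h1 : tau ^+ 2 * \int[g]_p (2 * c1 p + 2 * c2 p) <= 4 * L ^+ 2 * tau ^+ 2.
  by rewrite mulrC ler_wpM2r ?sqr_ge0.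
(* Passing to the positive part keeps the growth factor at least 1, as the iteration in time
   requires. *)
have h2 : \int[g]_p ip (delta p) (beta p) <=
    Num.max lam 0 * \int[g]_p `|delta p : X| ^+ 2.
  by apply: le_trans mean_dissipative _; rewrite ler_wpM2r// le_max lexx.
have {}h2 := ler_wpM2l (ltW (mulr_gt0 (ltr0n _ 2) tau0)) h2.
move: A0 h1 h2.
move: (\int[g]_p `|delta p : X| ^+ 2) (Num.max lam 0) => A ml A0 h1 h2.
by apply: le_trans (lerD (lerD (lexx _) h2) h1) _; lra.
Qed.

End OneStep.

(** * The path space *)

Section PathSpace.
Context {R : realType} {X : completeNormedModType R}.
Local Notation BX := (BXm R X).
Local Notation Xp := (Xp R X).
Local Notation coord := (Defs.coord R X).

(** The recursion mirrors the nested pairs of [Xp], so that [separable_dist_prod] applies at each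
    level. *)
Fixpoint dist_Xp (n : nat) : Xp n -> Xp n -> R :=
  match n return Xp n -> Xp n -> R with
  | 0 => fun x y => `|(x : X) - (y : X)|
  | n.+1 => fun x y => Num.max (@dist_Xp n x.1 y.1) `|(x.2 : X) - (y.2 : X)|
  end.

(** No bound on [k] appears: [coord] returns the initial point for an index beyond [n]. *)
Lemma dist_coord_le n (x y : Xp n) k :
  `|coord n x k - coord n y k| <= @dist_Xp n x y.
Proof.
elim: n x y => [//|n IH] x y /=; case: ifP => _; rewrite le_max ?lexx ?orbT//.
by rewrite IH.
Qed.

Lemma measurable_last_coord n :
  measurable_fun [set: Xp n] (last_coord R X n : Xp n -> BX).
Proof.
case: n => [|n]; first exact: measurable_id.
have := @measurable_snd _ _ (Xp n) BX; congr measurable_fun.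
by apply/funext => x; rewrite /last_coord /= eqxx.
Qed.

(** Each increment is weighted by a ramp that is 0 before its interval and 1 after it. Interpolation
    becomes a finite sum of continuous functions, with no gluing at the nodes. *)
Lemma affine_sum (a : nat -> X) (N k : nat) (u : R) : (k < N)%N ->
  k%:R <= u -> u <= k%:R + 1 ->
  \sum_(0 <= j < N) Num.max 0 (Num.min (u - j%:R) 1) *: (a j.+1 - a j) =
  a k - a 0%N + (u - k%:R) *: (a k.+1 - a k).
Proof.
move=> kN ku uk.
rewrite (big_cat_nat (n := k))//= ?(ltnW kN)//; congr (_ + _).
  rewrite -telescope_sumr//; apply: eq_big_nat => j /andP[_ jk].
  have : j%:R + 1 <= k%:R :> R by rewrite natr1 ler_nat.
  move=> jk1; rewrite min_r; last by lra.
  by rewrite max_r ?ler01// scale1r.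
rewrite big_ltn// big_nat big1 ?addr0 => [|j /andP[kj _]].
  by rewrite min_l ?max_r//; lra.
have : k%:R + 1 <= j%:R :> R by rewrite natr1 ler_nat.
by move=> kj1; rewrite max_l ?scale0r// ge_min; apply/orP; left; lra.
Qed.

Let affine_diff (u : R) (x0 x1 y0 y1 : X) :
  x0 + u *: (x1 - x0) - (y0 + u *: (y1 - y0)) =
  (1 - u) *: (x0 - y0) + u *: (x1 - y1).
Proof.
rewrite opprD addrACA -scalerBr scalerBl scale1r -[RHS]addrA; congr (_ + _).
rewrite [RHS]addrC -scalerBr; congr (_ *: _).
by rewrite !opprB [y0 - y1]addrC addrACA [- x0 + y0]addrC.
Qed.

Variables (tau T : R).
Hypotheses (tau0 : 0 < tau) (T0 : 0 < T).
Let N := Nsteps R tau T.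

Let NE : N%:R = (Num.ceil (T / tau))%:~R :> R.
Proof.
rewrite /N /Nsteps natr_absz ger0_norm// ltW// ceil_gt0.
by rewrite divr_gt0.
Qed.

Lemma Nsteps_gt0 : (0 < N)%N.
Proof. by rewrite absz_gt0 gt_eqF// ceil_gt0 divr_gt0. Qed.

Lemma Nsteps_ge : T <= N%:R * tau.
Proof. by rewrite -ler_pdivrMr// NE ceil_ge. Qed.

Lemma Nsteps_le : N%:R * tau <= T + tau.
Proof.
rewrite -ler_pdivlMr// mulrDl mulfV ?gt_eqF// NE -lerBlDr.
by have := ceilB1_lt (T / tau); rewrite intrB => /ltW.
Qed.

Let clamp (t : R) := Num.max 0 (Num.min t T).
(** The cap at [N.-1] assigns the end time, when it equals [N%:R * tau], to the last segment and not
    to one beyond the last node. *)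
Let idx (t : R) := minn (Num.truncn (clamp t / tau)) N.-1.

Let clamp_ge0 t : 0 <= clamp t. Proof. by rewrite le_max lexx. Qed.
Let clamp_leT t : clamp t <= T.
Proof. by rewrite ge_max (ltW T0) ge_min lexx orbT. Qed.

Let idx_lt t : (idx t < N)%N.
Proof. by rewrite gtn_min ltn_predL Nsteps_gt0 orbT. Qed.

Let idx_le t : (idx t)%:R <= clamp t / tau.
Proof.
have ct : 0 <= clamp t / tau by rewrite divr_ge0// ltW.
by rewrite -truncn_le in ct; apply: le_trans ct; rewrite ler_nat geq_minl.
Qed.

Let idx_ge t : clamp t / tau <= (idx t)%:R + 1.
Proof.
have ct : 0 <= clamp t / tau by rewrite divr_ge0// ltW.
rewrite /idx /minn; case: ifP => _.
  by rewrite natr1 ltW// truncnS_gt.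
rewrite natr1 prednK ?Nsteps_gt0// ler_pdivrMr//.
exact: le_trans (clamp_leT t) Nsteps_ge.
Qed.

Let interpE (x : Xp N) t : interp R X tau T N x t =
  coord N x (idx t) + (clamp t / tau - (idx t)%:R) *:
    (coord N x (idx t).+1 - coord N x (idx t)).
Proof.
rewrite /interp -/(clamp t) -/(idx t); congr (_ + _ *: _).
by rewrite mulrBl mulfK// gt_eqF.
Qed.

(** Both curves are affine on the same grid, so their difference at time [t] is a convex combination
    of its values at two neighbouring nodes. *)
Lemma interp_dist_le (x y : Xp N) (r : R) t :
  (forall k, (k <= N)%N -> `|coord N x k - coord N y k| <= r) ->
  `|interp R X tau T N x t - interp R X tau T N y t| <= r.
Proof.
move=> xyr; rewrite !interpE.
set u := clamp t / tau - _.
have u0 : 0 <= u by rewrite subr_ge0.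
have u1 : u <= 1 by rewrite lerBlDl.
have h0 := xyr _ (ltnW (idx_lt t)); have h1 := xyr _ (idx_lt t).
set x0 := coord N x (idx t) in h0 *; set y0 := coord N y (idx t) in h0 *.
set x1 := coord N x _.+1 in h1 *; set y1 := coord N y _.+1 in h1 *.
rewrite (_ : _ - _ = (1 - u) *: (x0 - y0) + u *: (x1 - y1)); last first.
  exact: affine_diff.
apply: le_trans (ler_normD _ _) _; rewrite !normrZ !ger0_norm ?subr_ge0//.
by nra.
Qed.

Lemma interp_continuous (x : Xp N) : cont_on R X T (interp R X tau T N x).
Proof.
apply: continuous_subspaceT.
have -> : interp R X tau T N x = fun t => coord N x 0%N +
    \sum_(0 <= j < N) Num.max 0 (Num.min (clamp t / tau - j%:R) 1) *:
      (coord N x j.+1 - coord N x j).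
  apply/funext => t; rewrite (affine_sum _ (idx_lt t) (idx_le t) (idx_ge t)).
  by rewrite addrA subrKC interpE.
move=> t; apply: cvgD; first exact: cvg_cst.
apply: cvg_big => [|j _]; first exact: add_continuous.
apply: cvgZ; last exact: cvg_cst.
have cs (f : R -> R) (a b : R) : {for t, continuous f} ->
    {for t, continuous (fun s => Num.max a (Num.min (f s) b))}.
  move=> cf; apply: (@continuous_max _ _ (cst a) (fun s => Num.min (f s) b)).
    exact: cst_continuous.
  by apply: (@continuous_min _ _ f (cst b)) => //; exact: cst_continuous.
apply: (cs (fun s => clamp s / tau - j%:R)).
apply: cvgB; last exact: cvg_cst.
apply: cvgM; last exact: cvg_cst.
by apply: (cs id); exact: cvg_id.
Qed.

Lemma Gpath_sval (x : Xp N) : sval (Gpath R X tau T N x) = interp R X tau T N x.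
Proof.
by rewrite /Gpath; case: pselect => [//|[]]; exact: interp_continuous.
Qed.

Lemma supdist_Gpath_le (x y : Xp N) (r : R) :
  (forall k, (k <= N)%N -> `|coord N x k - coord N y k| <= r) ->
  0 <= supdist R X T (Gpath R X tau T N x) (Gpath R X tau T N y) <= r.
Proof.
move=> xyr; rewrite /supdist; set E := (X in sup X).
have E0 : E `|sval (Gpath R X tau T N x) 0 - sval (Gpath R X tau T N y) 0|.
  by exists 0 => //=; rewrite in_itv /= lexx ltW.
have Er : ubound E r.
  by move=> _ [t _ <-]; rewrite !Gpath_sval; exact: interp_dist_le.
apply/andP; split; last by apply: ge_sup => //; eexists; exact: E0.
by apply: le_trans (ub_le_sup _ E0) => //; exists r.
Qed.

Hypothesis sepX : separable_space X.

Lemma separable_dist_Xp n : separable_dist (@dist_Xp n).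
Proof.
elim: n => [|n IH]; first exact: separable_dist_BX.
exact: separable_dist_prod IH (separable_dist_BX sepX).
Qed.

(** [Gpath] is 1-Lipschitz from [dist_Xp] to the supremum distance, so preimages of the generating
    sets [cx_open] are open for [dist_Xp]. *)
Lemma measurable_Gpath : measurable_fun setT (Gpath R X tau T N).
Proof.
apply: (dist_open_measurable_fun (@separable_dist_Xp N)) => A oA x Ax.
have [r r0 rA] := oA _ Ax; exists r => // y xy; apply: rA.
apply: le_lt_trans xy.
have /andP[_] := @supdist_Gpath_le x y _ (fun k _ => dist_coord_le x y k).
exact.
Qed.

End PathSpace.

(** * Chains of independent steps *)

Section ChainStep.
Context {R : realType} {X : completeNormedModType R} {ip : X -> X -> R}.
Hypothesis hip : hilbert_ip R X ip.
Hypothesis sepX : separable_space X.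
Local Notation BX := (BXm R X).
Local Notation TX := (TX R X).
Variables (F : set (probability TX R)) (lam L tau : R).
Hypothesis diss : tot_dissipative R X ip lam (bar_field R X ip F).
Hypothesis tau0 : 0 < tau.

Definition velocity_of (K V : BX -> probability BX R) :=
  forall x (f : BX -> \bar R), (forall y, 0 <= f y)%E -> measurable_fun setT f ->
    (\int[K x]_y f y = \int[V x]_v f (((x : X) + tau *: (v : X))%R : BX))%E.

Variables (Phi1 Phi2 : probability TX R) (M1 M2 : probability BX R).
Variables (V1 V2 K1 K2 : BX -> probability BX R) (b1 b2 : BX -> BX).
Hypotheses (D1 : step_data (ip := ip) F L Phi1 M1 V1 b1).
Hypotheses (D2 : step_data (ip := ip) F L Phi2 M2 V2 b2).
Hypotheses (KV1 : velocity_of K1 V1) (KV2 : velocity_of K2 V2).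
Hypothesis mK1 : forall B, measurable B -> measurable_fun setT (K1 ^~ B).
Hypothesis mK2 : forall B, measurable B -> measurable_fun setT (K2 ^~ B).

Context {d1 d2} {S1 : measurableType d1} {S2 : measurableType d2}.
Variables (A : probability (S1 * S2)%type R) (l1 : S1 -> BX) (l2 : S2 -> BX).
Hypotheses (ml1 : measurable_fun setT l1) (ml2 : measurable_fun setT l2).
Hypothesis A1 : forall B, measurable B -> A ((l1 @^-1` B) `*` setT) = M1 B.
Hypothesis A2 : forall B, measurable B -> A (setT `*` (l2 @^-1` B)) = M2 B.

Let ml : measurable_fun setT (fun s : S1 * S2 => (l1 s.1, l2 s.2)).
Proof.
apply: measurable_fun_pair; first exact: (measurableT_comp ml1 measurable_fst).
exact: (measurableT_comp ml2 measurable_snd).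
Qed.

(** The joint law of the current positions: this is all of the past that the next step sees. *)
Let g := pushp A ml.

Let cg : coupling M1 M2 g.
Proof. by split => B mB; [rewrite -A1|rewrite -A2]. Qed.

Lemma measurable_kernel_comp1 B : measurable B ->
  measurable_fun setT ((fun s => K1 (l1 s)) ^~ B).
Proof. by move=> mB; exact: (measurableT_comp (mK1 mB) ml1). Qed.

Lemma measurable_kernel_comp2 B : measurable B ->
  measurable_fun setT ((fun s => K2 (l2 s)) ^~ B).
Proof. by move=> mB; exact: (measurableT_comp (mK2 mB) ml2). Qed.

Let A' := joint_ext A measurable_kernel_comp1 measurable_kernel_comp2.

Lemma chain_old (h : S1 * S2 -> \bar R) : (forall s, 0 <= h s)%E ->
  measurable_fun setT h ->
  (\int[A']_z h (z.1.1, z.2.1) = \int[A]_s h s)%E.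
Proof.
move=> h0 mh; rewrite ge0_integral_joint_ext => //; last first.
  apply: (measurableT_comp mh); apply: measurable_fun_pair;
    exact: measurableT_comp.
apply: eq_integral => -[s1 s2] _ /=.
rewrite -[RHS](integral_cst_probability (K1 (l1 s1))).
by apply: eq_integral => y1 _; rewrite integral_cst_probability.
Qed.

(** Quantities that involve only the current and next positions reduce to a one-step integral over
    [g] and the velocity kernels, where the estimates of a single step apply. *)
Lemma chain_new (f : (BX * BX) * (BX * BX) -> \bar R) : (forall z, 0 <= f z)%E ->
  measurable_fun setT f ->
  (\int[A']_z f ((l1 z.1.1, z.1.2), (l2 z.2.1, z.2.2)) =
   \int[g]_p \int[V1 p.1]_v \int[V2 p.2]_w
     f ((p.1, ((p.1 : X) + tau *: (v : X))%R), (p.2, ((p.2 : X) + tau *: (w : X))%R)))%E.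
Proof.
move=> f0 mf; rewrite ge0_integral_joint_ext => //; last first.
  apply: (measurableT_comp mf); apply: measurable_fun_pair;
    apply: measurable_fun_pair; do ?exact: measurableT_comp.
  - by apply: (measurableT_comp ml1); exact: measurableT_comp.
  - by apply: (measurableT_comp ml2); exact: measurableT_comp.
transitivity (\int[g]_p \int[K1 p.1]_y1 \int[K2 p.2]_y2
    f ((p.1, y1), (p.2, y2)))%E.
  rewrite (ge0_integral_pushp A ml (measurable_joint_inner mK1 mK2 f0 mf))// => p.
  by apply: integral_ge0 => v _; exact: integral_ge0.
apply: eq_integral => -[x y] _ /=.
have mfx y1 : measurable_fun setT (fun y2 => f ((x, y1), (y, y2))).
  by apply: (measurableT_comp mf); apply: measurable_fun_pair => //;
    apply: measurable_fun_pair.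
have mfy : measurable_fun setT (fun y1 => \int[K2 y]_y2 f ((x, y1), (y, y2)))%E.
  apply: (@measurable_integral_kernel _ _ _ _ _ (fun=> K2 y) _
    (fun q => f ((x, q.1), (y, q.2)))) => //.
  apply: (measurableT_comp mf); apply: measurable_fun_pair;
    exact: measurable_fun_pair.
rewrite KV1//; last by move=> y1; exact: integral_ge0.
by apply: eq_integral => v _; rewrite KV2.
Qed.

Let mfst2 : measurable_fun setT (fun z : (BX * BX) * (BX * BX) => z.1.2).
Proof. exact: measurableT_comp. Qed.
Let msnd2 : measurable_fun setT (fun z : (BX * BX) * (BX * BX) => z.2.2).
Proof. exact: measurableT_comp. Qed.
Let mfst1 : measurable_fun setT (fun z : (BX * BX) * (BX * BX) => z.1.1).
Proof. exact: measurableT_comp. Qed.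
Let msnd1 : measurable_fun setT (fun z : (BX * BX) * (BX * BX) => z.2.1).
Proof. exact: measurableT_comp. Qed.

Lemma chain_dist :
  (\int[A]_s (`|(l1 s.1 : X) - (l2 s.2 : X)| ^+ 2)%:E < +oo)%E ->
  (\int[A']_z (`|(z.1.2 : X) - (z.2.2 : X)| ^+ 2)%:E <=
   (1 + 2 * Num.max lam 0 * tau)%:E *
     \int[A]_s (`|(l1 s.1 : X) - (l2 s.2 : X)| ^+ 2)%:E +
   (4 * L ^+ 2 * tau ^+ 2)%:E)%E.
Proof.
have md : measurable_fun setT (fun p : BX * BX => (`|(p.1 : X) - (p.2 : X)| ^+ 2)%:E).
  apply/measurable_EFinP; apply: (measurable_sqnormv
    (f := fun p : BX * BX => (p.1 : X) - (p.2 : X) : BX)).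
  exact: measurable_subv.
have -> : (\int[A]_s (`|(l1 s.1 : X) - (l2 s.2 : X)| ^+ 2)%:E =
    \int[g]_p (`|(p.1 : X) - (p.2 : X)| ^+ 2)%:E)%E.
  by apply/esym/(ge0_integral_pushp A ml md) => p; rewrite lee_fin sqr_ge0.
move=> dfin; rewrite (chain_new (f := fun z => (`|(z.1.2 : X) - (z.2.2 : X)| ^+ 2)%:E)).
- under eq_integral do under eq_integral do under eq_integral do
    rewrite /= opprD addrACA -scalerBr.
  exact: (step_dist_le hip sepX diss D1 D2 cg).
- by move=> z; rewrite lee_fin sqr_ge0.
- apply/measurable_EFinP; apply: (measurable_sqnormv
    (f := fun z : (BX * BX) * (BX * BX) => (z.1.2 : X) - (z.2.2 : X) : BX)).
  exact: measurable_subv.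
Qed.

Lemma chain_speed :
  (\int[A']_z (`|tau^-1 *: (((z.1.2 : X) - (l1 z.1.1 : X)) -
      ((z.2.2 : X) - (l2 z.2.1 : X)))| ^+ 2)%:E <= (4 * L ^+ 2)%:E)%E.
Proof.
rewrite (chain_new (f := fun z => (`|tau^-1 *: (((z.1.2 : X) - (z.1.1 : X)) -
      ((z.2.2 : X) - (z.2.1 : X)))| ^+ 2)%:E)).
- have e (x v : X) : x + tau *: v - x = tau *: v by rewrite addrAC subrr add0r.
  under eq_integral do under eq_integral do under eq_integral do
    rewrite /= !e -scalerBr scalerA mulVf ?gt_eqF// scale1r.
  exact: (step_speed_le hip sepX D1 D2 cg).
- by move=> z; rewrite lee_fin sqr_ge0.
- apply/measurable_EFinP; apply: (measurable_sqnormv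
    (f := fun z : (BX * BX) * (BX * BX) => tau^-1 *: (((z.1.2 : X) - (z.1.1 : X)) -
      ((z.2.2 : X) - (z.2.1 : X))) : BX)).
  apply: measurable_scalev.
  by apply: measurable_subv => //; apply: measurable_subv.
Qed.

End ChainStep.

(** * Coupling of two Euler chains over all steps *)

Section EulerChain.
Context {R : realType} {X : completeNormedModType R} {ip : X -> X -> R}.
Hypothesis hip : hilbert_ip R X ip.
Hypothesis sepX : separable_space X.
Local Notation BX := (BXm R X).
Local Notation TX := (TX R X).
Local Notation Xp := (Xp R X).
Local Notation coord := (Defs.coord R X).
Local Notation last_coord := (last_coord R X).
Variables (F : set (probability TX R)) (lam L tau : R).
Hypothesis diss : tot_dissipative R X ip lam (bar_field R X ip F).
Hypothesis tau0 : 0 < tau.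

Record euler_chain (N : nat) (M : nat -> probability BX R)
    (K : nat -> BX -> probability BX R) (al : forall n, probability (Xp n) R) := {
  ec_kernel : forall n, (n < N)%N -> forall B, measurable B ->
    measurable_fun setT (K n ^~ B);
  ec_step : forall n, (n < N)%N -> exists Phi V b,
    step_data (ip := ip) F L Phi (M n) V b /\ velocity_of tau (K n) V;
  ec_law0 : forall B, measurable B -> al 0%N B = M 0%N B;
  ec_law : forall n, (n < N)%N -> forall E : set (Xp n.+1), measurable E ->
    al n.+1 E = (\int[al n]_x K n (last_coord n x) (xsection E x))%E;
  ec_last : forall n, (n <= N)%N -> forall B : set BX, measurable B ->
    al n (last_coord n @^-1` B) = M n B }.

(** [multistep_plan] constrains the laws from index 1 on. Putting [M0] at index 0 lets the induction
    on the number of steps start from a single point. *)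
Definition chain_law (M0 : probability BX R) (al : forall n, probability (Xp n) R)
    n : probability (Xp n) R :=
  match n return probability (Xp n) R with 0 => M0 | m.+1 => al m.+1 end.

Lemma scheme_step T mu0 M Phi K n : 0 < T -> 0 < L ->
  stable_solution R X F tau T L mu0 M Phi -> (n < Nsteps R tau T)%N ->
  disintegrates (step_plan R X tau (Phi n)) (M n) (K n) ->
  exists V b, step_data (ip := ip) F L (Phi n) (M n) V b /\ velocity_of tau (K n) V.
Proof.
move=> T0 L0 [_ [FM [sp _]]] nN dK.
have [V [dV KV]] := exists_velocity_kernel sepX tau0 dK.
have [b bP] := exists_mean_kernel hip sepX dV.1.
have [Fn Mn] := FM _ (ltnW nN).
exists V, b; split => //; split => //.
have := sp _ nN; rewrite /vnorm2.
rewrite -[in leRHS](gtr0_norm L0) -sqrtr_sqr.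
by rewrite -[X in (_ <= X)%E]/(sqrte (L ^+ 2)%:E) lee_sqrt// lee_fin sqr_ge0.
Qed.

Lemma scheme_euler_chain T mu0 M Phi al : 0 < T -> 0 < L ->
  stable_solution R X F tau T L mu0 M Phi ->
  multistep_plan R X tau T M Phi al ->
  exists K, euler_chain (Nsteps R tau T) M K (chain_law (M 0%N) al).
Proof.
move=> T0 L0 sol [K [dK [al1 alS]]]; set N := Nsteps R tau T in dK alS *.
exists K.
have mst : measurable_fun setT (fun p : TX => ((p.1, expt R X tau p) : BX * BX)).
  by apply: measurable_fun_pair => //; exact: measurable_expt.
have mK n : (n < N)%N -> forall B, measurable B -> measurable_fun setT (K n ^~ B).
  by move=> /dK[].
have law n : (n < N)%N -> forall E : set (Xp n.+1), measurable E ->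
    chain_law (M 0%N) al n.+1 E =
    (\int[chain_law (M 0%N) al n]_x K n (last_coord n x) (xsection E x))%E.
  case: n => [|n] nN E mE; last exact: alS.
  have dK' : disintegrates (pushp (Phi 0%N) mst) (M 0%N) (K 0%N) := dK _ nN.
  have := disintegrates_semid (mK _ nN) dK' mE; rewrite semidE => <-.
  exact: al1.
split => //; first by move=> n nN; exists (Phi n); exact: scheme_step sol nN (dK _ nN).
(* Averaging [K n] over [M n] gives the second marginal of the step plan, which the scheme
   identifies with [M n.+1]. *)
elim => [//|n IH] nN B mB.
have mlc := @measurable_last_coord R X.
have := mlc n.+1 measurableT _ mB; rewrite setTI => ml; rewrite law//.
transitivity (\int[M n]_x K n x B)%E.
  transitivity (\int[pushp (chain_law (M 0%N) al n) (mlc n)]_x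
      K n x B)%E; last first.
    by apply: eq_measure_integral => C mC _; apply: (IH (ltnW nN)).
  rewrite ge0_integral_pushp//; last exact: mK.
  apply: eq_integral => x _; congr (K n _ _); rewrite xsectionE.
  by apply/seteqP; split => y; rewrite /preimage /= /Defs.last_coord /= eqxx.
case: sol => _ [_ [_ /(_ n.+1)]]; rewrite /= nN => /(_ isT) ->//.
rewrite -(dK _ nN).2// /step_plan /pushforward.
by congr (Phi n _); apply/seteqP; split => p //= [].
Qed.

Variables (N : nat) (M1 M2 : nat -> probability BX R).
Variables (K1 K2 : nat -> BX -> probability BX R).
Variables (al1 al2 : forall n, probability (Xp n) R).
Hypotheses (C1 : euler_chain N M1 K1 al1) (C2 : euler_chain N M2 K2 al2).
Variables (g : probability (BX * BX)%type R) (a0 B eps : R).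
Hypothesis cg : coupling (M1 0%N) (M2 0%N) g.
Hypothesis eps0 : 0 < eps.
Hypothesis ga0 : (\int[g]_p (`|(p.1 : X) - (p.2 : X)| ^+ 2)%:E <= a0%:E)%E.

Let rate := 2 * Num.max lam 0.
(** The discrete Gronwall bound for the mean squared distance after [n] steps. *)
Let dist_bound (n : nat) :=
  expR (rate * (n%:R * tau)) * (a0 + n%:R * (4 * L ^+ 2 * tau ^+ 2)).
(** What one step adds to the mean of the dominating function [S], given the speed bound
    [4 * L ^+ 2] and the uniform distance bound [B]. *)
Let incr := tau * (eps * (4 * L ^+ 2) + B / eps) + tau ^+ 2 * (4 * L ^+ 2).
Let sup_bound (n : nat) := a0 + n%:R * incr.

Hypothesis distB : forall n, (n <= N)%N -> dist_bound n <= B.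

Let dist2 n (p : Xp n * Xp n) : R :=
  `|(last_coord n p.1 : X) - (last_coord n p.2 : X)| ^+ 2.

Let mdist2 n : measurable_fun setT (@dist2 n).
Proof.
apply: (measurable_sqnormv (f := fun p : Xp n * Xp n =>
  (last_coord n p.1 : X) - (last_coord n p.2 : X) : BX)).
apply: measurable_subv => //.
  exact: (measurableT_comp (@measurable_last_coord R X n) measurable_fst).
exact: (measurableT_comp (@measurable_last_coord R X n) measurable_snd).
Qed.

Let a0_ge0 : 0 <= a0.
Proof.
rewrite -lee_fin; apply: le_trans ga0; apply: integral_ge0 => p _.
by rewrite lee_fin sqr_ge0.
Qed.

(** The growth factor is below its exponential by [1 + x <= expR x], and the new error term is only
    enlarged when multiplied by exponentials that are at least 1. *)
Let dist_boundS n :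
  (1 + 2 * Num.max lam 0 * tau) * dist_bound n + 4 * L ^+ 2 * tau ^+ 2 <=
  dist_bound n.+1.
Proof.
have r0 : 0 <= rate * tau.
  by rewrite mulr_ge0 ?(ltW tau0)// mulr_ge0// le_max lexx orbT.
have rn0 : 0 <= rate * (n%:R * tau) by rewrite mulrCA mulr_ge0.
have e1 := expR_ge1Dx (rate * tau).
have en : 1 <= expR (rate * (n%:R * tau)).
  by apply: le_trans (expR_ge1Dx _); rewrite lerDl.
rewrite /dist_bound -[n.+1%:R]natr1 [(n%:R + 1) * tau]mulrDl mul1r.
rewrite [rate * (_ + tau)]mulrDr expRD -/rate.
set c := 4 * L ^+ 2 * tau ^+ 2.
have c0 : 0 <= c by rewrite mulr_ge0 ?sqr_ge0// mulr_ge0 ?sqr_ge0.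
move: e1 en; set e := expR (rate * tau); set en := expR _ => e1 en1.
have e1' : 1 <= e by apply: le_trans e1; rewrite lerDl.
have een : 1 <= en * e by rewrite -[1]mulr1 ler_pM.
rewrite [(n%:R + 1) * c]mulrDl mul1r addrA.
set b := a0 + n%:R * c; have b0 : 0 <= b by rewrite addr_ge0// mulr_ge0.
rewrite [_ * (b + c)]mulrDr; apply: lerD; last by rewrite ler_peMl.
by rewrite mulrA [en * e]mulrC ler_wpM2r// ler_wpM2r// expR_ge0.
Qed.

(* [S] dominates every squared distance along the chain: it accumulates
   [2 tau |u| |D| + tau^2 |u|^2], where [D] is the current difference and [u]
   the difference of velocities, with the product split by AM-GM at scale
   [eps]. *)
Lemma chain_coupling n : (n <= N)%N ->
  exists (A : probability (Xp n * Xp n)%type R) (S : Xp n * Xp n -> R),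
  [/\ coupling (al1 n) (al2 n) A,
      (\int[A]_p (dist2 p)%:E <= (dist_bound n)%:E)%E,
      measurable_fun setT S,
      (forall p k, `|coord n p.1 k - coord n p.2 k| ^+ 2 <= S p) &
      (\int[A]_p (S p)%:E <= (sup_bound n)%:E)%E].
Proof.
elim: n => [_|n IH nN].
  exists g, (fun p => `|(p.1 : X) - (p.2 : X)| ^+ 2); split => //.
  - by split => C mC; [rewrite (ec_law0 C1)//; exact: cg.1
                      |rewrite (ec_law0 C2)//; exact: cg.2].
  - by rewrite /dist_bound mul0r mulr0 expR0 mul1r mul0r addr0.
  - by rewrite /sup_bound mul0r addr0.
have [A [S [cA dA mS Sk SA]]] := IH (ltnW nN).
have [Phi1 [V1 [b1 [D1 KV1]]]] := ec_step C1 nN.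
have [Phi2 [V2 [b2 [D2 KV2]]]] := ec_step C2 nN.
have ml := @measurable_last_coord R X n.
have mlB (C : set BX) : measurable C -> measurable (last_coord n @^-1` C).
  by move=> mC; have := ml measurableT _ mC; rewrite setTI.
have A1 (C : set BX) : measurable C -> A ((last_coord n @^-1` C) `*` setT) = M1 n C.
  by move=> mC; rewrite cA.1 ?(ec_last C1 (ltnW nN))//; exact: mlB.
have A2 (C : set BX) : measurable C -> A (setT `*` (last_coord n @^-1` C)) = M2 n C.
  by move=> mC; rewrite cA.2 ?(ec_last C2 (ltnW nN))//; exact: mlB.
have mK1 := ec_kernel C1 nN; have mK2 := ec_kernel C2 nN.
pose A' := joint_ext A (measurable_kernel_comp1 mK1 ml)
                       (measurable_kernel_comp2 mK2 ml).
pose u2 (z : Xp n.+1 * Xp n.+1) : R :=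
  `|tau^-1 *: (((z.1.2 : X) - (last_coord n z.1.1 : X)) -
               ((z.2.2 : X) - (last_coord n z.2.1 : X)))| ^+ 2.
pose old (z : Xp n.+1 * Xp n.+1) : Xp n * Xp n := (z.1.1, z.2.1).
pose S' (z : Xp n.+1 * Xp n.+1) : R :=
  S (old z) + (tau * eps + tau ^+ 2) * u2 z + tau / eps * dist2 (old z).
have S0 p : 0 <= S p by apply: le_trans (Sk p 0%N); exact: sqr_ge0.
have c1 : 0 <= tau * eps + tau ^+ 2 
  by rewrite addr_ge0 ?sqr_ge0// mulr_ge0// ltW.
have c2 : 0 <= tau / eps by rewrite divr_ge0// ltW.
have mold : measurable_fun setT old.
  by apply: measurable_fun_pair; exact: measurableT_comp.
have mu2 : measurable_fun setT u2.
  apply: (measurable_sqnormv (f := fun z : Xp n.+1 * Xp n.+1 =>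
    tau^-1 *: (((z.1.2 : X) - (last_coord n z.1.1 : X)) -
               ((z.2.2 : X) - (last_coord n z.2.1 : X))) : BX)).
  apply: measurable_scalev; apply: measurable_subv => //;
    apply: measurable_subv => //; try exact: measurableT_comp.
  + by apply: (measurableT_comp ml); exact: measurableT_comp.
  + by apply: (measurableT_comp ml); exact: measurableT_comp.
have mSo : measurable_fun setT (S \o old) by exact: measurableT_comp.
have mdo : measurable_fun setT (@dist2 n \o old).
  exact: (measurableT_comp (@mdist2 n)).
have Idist2 : (\int[A]_p (dist2 p)%:E < +oo)%E by exact: le_lt_trans dA (ltry _).
have rate0 : 0 <= 1 + 2 * Num.max lam 0 * tau.
  by rewrite addr_ge0// mulr_ge0 ?(ltW tau0)// mulr_ge0// le_max lexx orbT.
exists A', S'; split.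
- have [cA1 cA2] := joint_ext_coupling (measurable_kernel_comp1 mK1 ml)
    (measurable_kernel_comp2 mK2 ml) cA.
  split => C mC.
    by rewrite (ec_law C1 nN)//; have := cA1 _ mC; rewrite semidE.
  by rewrite (ec_law C2 nN)//; have := cA2 _ mC; rewrite semidE.
- have := chain_dist hip sepX diss tau0 D1 D2 KV1 KV2 mK1 mK2 ml ml A1 A2 Idist2.
  have -> : (\int[A']_z (`|(z.1.2 : X) - (z.2.2 : X)| ^+ 2)%:E =
      \int[A']_z (@dist2 n.+1 z)%:E)%E.
    by apply: eq_integral => z _; rewrite /dist2 /Defs.last_coord /= !eqxx.
  move=> /le_trans; apply; apply: le_trans (_ : ((1 + 2 * Num.max lam 0 * tau) *
      dist_bound n + 4 * L ^+ 2 * tau ^+ 2)%:E <= _)%E; last by rewrite lee_fin.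
  by rewrite [leRHS]EFinD leeD2r// [leRHS]EFinM lee_wpmul2l// lee_fin.
- apply: measurable_funD; last by apply: measurable_funM.
  by apply: measurable_funD => //; apply: measurable_funM.
- move=> z k /=; case: ifP => [_|_]; last first.
    apply: le_trans (Sk (old z) k) _; rewrite /S' -addrA lerDl.
    by rewrite addr_ge0// mulr_ge0// sqr_ge0.
  set D : X := last_coord n z.1.1 - last_coord n z.2.1.
  set u : X := tau^-1 *: (((z.1.2 : X) - (last_coord n z.1.1 : X)) -
               ((z.2.2 : X) - (last_coord n z.2.1 : X))).
  have -> : (z.1.2 : X) - (z.2.2 : X) = D + tau *: u.
    rewrite /u scalerA mulfV ?gt_eqF// scale1r /D opprB addrACA.
    by rewrite [_ + (_ - last_coord n z.1.1)]addrC subrK addKr.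
  have DS : `|D| ^+ 2 <= S (old z) by exact: (Sk (old z) n).
  (* AM-GM, from the nonnegativity of the squared norm of [D - eps *: u]. *)
  have h : 2 * ip D u <= eps * `|u| ^+ 2 + `|D| ^+ 2 / eps.
    have := sqr_ge0 `|D - eps *: u|; rewrite (sqnormB hip) (ipZr hip) normrZ.
    rewrite exprMn real_normK ?num_real// => h.
    rewrite -(ler_pM2l eps0) mulrDr [eps * (_ / eps)]mulrCA mulfV ?gt_eqF// mulr1.
    by nra.
  rewrite (sqnormD hip) (ipZr hip) normrZ exprMn real_normK ?num_real//.
  rewrite /S' /u2 /dist2 -/u -/D.
  have := ler_wpM2l (ltW tau0) h; rewrite mulrDr => {}h.
  rewrite [tau / eps * _]mulrAC -mulrA.
  by move: DS h; rewrite !mulrA; lra.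
- rewrite /S'.
  under eq_integral do rewrite !EFinD.
  rewrite ge0_integralD//; last first.
  + by apply/measurable_EFinP; exact: measurable_funM.
  + by move=> z _; rewrite lee_fin mulr_ge0// sqr_ge0.
  + by apply/measurable_EFinP; apply: measurable_funD => //; exact: measurable_funM.
  + by move=> z _; rewrite lee_fin addr_ge0// mulr_ge0// sqr_ge0.
  rewrite ge0_integralD//; last first.
  + by apply/measurable_EFinP; exact: measurable_funM.
  + by move=> z _; rewrite lee_fin mulr_ge0// sqr_ge0.
  + exact/measurable_EFinP.
  + by move=> z _; rewrite lee_fin.
  have t1 : (\int[A']_z (S (old z))%:E <= (sup_bound n)%:E)%E.
    apply: le_trans SA; rewrite (chain_old mK1 mK2 A ml ml (h := fun p => (S p)%:E))//.
    exact/measurable_EFinP.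
  have t2 : (\int[A']_z ((tau * eps + tau ^+ 2) * u2 z)%:E <=
      ((tau * eps + tau ^+ 2) * (4 * L ^+ 2))%:E)%E.
    under eq_integral do rewrite EFinM.
    rewrite ge0_integralZl_EFin => [|//|z _||//]; last 2 first.
    + by rewrite lee_fin sqr_ge0.
    + exact/measurable_EFinP.
    rewrite [leRHS]EFinM lee_wpmul2l ?lee_fin//.
    exact: (chain_speed hip sepX tau0 D1 D2 KV1 KV2 mK1 mK2 ml ml A1 A2).
  have t3 : (\int[A']_z (tau / eps * dist2 (old z))%:E <= (tau / eps * B)%:E)%E.
    have d0 p : (0 <= (@dist2 n p)%:E)%E by rewrite lee_fin sqr_ge0.
    have md : measurable_fun setT (fun p => (@dist2 n p)%:E).
      exact/measurable_EFinP.
    under eq_integral do rewrite EFinM.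
    rewrite ge0_integralZl_EFin => [|//|z _||//]; last 2 first.
    + exact: d0.
    + exact/measurable_EFinP.
    rewrite [leRHS]EFinM lee_wpmul2l ?lee_fin// (chain_old mK1 mK2 A ml ml d0 md).
    by apply: le_trans dA _; rewrite lee_fin; apply: distB; exact: ltnW.
  apply: le_trans (leeD (leeD t1 t2) t3) _.
  rewrite -!EFinD lee_fin /sup_bound -[n.+1%:R]natr1 /incr.
  rewrite le_eqVlt; apply/orP; left; apply/eqP; field.
  by rewrite gt_eqF.
Qed.

End EulerChain.

(** * Proof of the estimate *)

(** A coupling within [e] of the infimum avoids the question of whether an optimal one exists. *)
Lemma W2_near_optimal {R : realType} {d} {T : measurableType d}
    (dist : T -> T -> R) (mu nu : probability T R) (e : R) : 0 < e ->
  (W2 dist mu nu < +oo)%E ->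
  exists w : R, [/\ 0 <= w, W2 dist mu nu = w%:E &
    exists2 g, coupling mu nu g &
      (\int[g]_p ((dist p.1 p.2) ^+ 2)%:E <= (w ^+ 2 + e)%:E)%E].
Proof.
move=> e0; rewrite /W2; set S := [set _ | _ in _]; move=> Wy.
have S0 : (0 <= ereal_inf S)%E.
  apply: le_ereal_inf_tmp => _ [g _ <-].
  by apply: integral_ge0 => p _; rewrite lee_fin sqr_ge0.
have fS : ereal_inf S \is a fin_num.
  by rewrite -sqrte_fin_num// ge0_fin_numE// sqrte_ge0.
have [_ [g cg <-] gS] := lb_ereal_inf_adherent e0 fS.
exists (Num.sqrt (fine (ereal_inf S))); split; first exact: sqrtr_ge0.
  by rewrite -[in LHS](fineK fS).
exists g => //; apply: ltW; rewrite sqr_sqrtr ?fine_ge0//.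
by rewrite EFinD fineK.
Qed.

Lemma sqrtrD_le {R : realType} (a b : R) : 0 <= a -> 0 <= b ->
  Num.sqrt (a + b) <= Num.sqrt a + Num.sqrt b.
Proof.
move=> a0 b0; rewrite -(ler_pXn2r (n := 2))// ?nnegrE ?addr_ge0 ?sqrtr_ge0//.
rewrite sqr_sqrtr ?addr_ge0// sqrrD !sqr_sqrtr//.
by rewrite -addrA [_ *+ 2 + _]addrC addrA lerDl mulrn_wge0// mulr_ge0 ?sqrtr_ge0.
Qed.

Section Constants.
Context {R : realType}.
Variables (lam L T tau w : R).
Hypotheses (T0 : 0 < T) (tau0 : 0 < tau) (tau1 : tau < 1).
Hypotheses (w0 : 0 <= w) (w1 : w < 1).

Let c := 4 * L ^+ 2.
Let growth := expR (2 * Num.max lam 0 * (T + 1)).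
Let eps := w + Num.sqrt tau.
Let N := Nsteps R tau T.

(** The summand 2 comes from [w ^+ 2 + tau <= eps ^+ 2 <= 2 * eps], the middle one from the AM-GM
    terms summed over [N%:R * tau <= T + 1], and the last from the quadratic terms, where
    [tau <= eps ^+ 2 <= 2 * eps]. *)
Definition sup_const : R :=
  2 + (T + 1) * (c + growth * (1 + (T + 1) * c)) + 2 * (T + 1) * c.

Let c0 : 0 <= c. Proof. by rewrite mulr_ge0// sqr_ge0. Qed.

Let sqtau : Num.sqrt tau ^+ 2 = tau. Proof. by rewrite sqr_sqrtr// ltW. Qed.

Let eps0 : 0 < eps. Proof. by rewrite ltr_wpDl// sqrtr_gt0. Qed.

Let eps2 : w ^+ 2 + tau <= eps ^+ 2.
Proof.
rewrite -{1}sqtau /eps; have := sqrtr_ge0 tau.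
by have := w0; nra.
Qed.

Let tau_eps : tau <= eps ^+ 2.
Proof. by apply: le_trans eps2; rewrite lerDr sqr_ge0. Qed.

Let eps_sq : eps ^+ 2 <= 2 * eps.
Proof.
have s1 : Num.sqrt tau <= 1 by rewrite -sqrtr1 ler_wsqrtr// ltW.
rewrite expr2 ler_wpM2r ?(ltW eps0)// /eps.
by have := w1; lra.
Qed.

Let Ntau : N%:R * tau <= T + 1.
Proof. by apply: le_trans (Nsteps_le tau0 T0) _; rewrite lerD2l ltW. Qed.

(** Being of order [eps ^+ 2], it makes [B / eps] of order [eps], so both halves of the AM-GM
    splitting have the same size. *)
Let B := growth * (1 + (T + 1) * c) * eps ^+ 2.

Lemma dist_bound_le n : (n <= N)%N ->
  expR (2 * Num.max lam 0 * (n%:R * tau)) *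
    (w ^+ 2 + tau + n%:R * (4 * L ^+ 2 * tau ^+ 2)) <= B.
Proof.
move=> nN; rewrite -/c /B -[leRHS]mulrA.
have nt : n%:R * tau <= T + 1.
  by apply: le_trans Ntau; rewrite ler_pM2r// ler_nat.
apply: ler_pM; first exact: expR_ge0.
- rewrite addr_ge0 ?addr_ge0 ?sqr_ge0 ?(ltW tau0)//.
  by rewrite mulr_ge0// mulr_ge0// sqr_ge0.
- by rewrite /growth ler_expR ler_wpM2l// mulr_ge0// le_max lexx orbT.
- rewrite mulrDl mul1r lerD//.
  rewrite (_ : n%:R * _ = (n%:R * tau) * c * tau); last by ring.
  apply: ler_pM => //; [|exact: ltW|].
    by rewrite mulr_ge0// mulr_ge0// ltW.
  by rewrite ler_wpM2r.
Qed.

Lemma sup_bound_le :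
  w ^+ 2 + tau + N%:R *
    (tau * (eps * (4 * L ^+ 2) + B / eps) + tau ^+ 2 * (4 * L ^+ 2)) <=
  sup_const * eps.
Proof.
rewrite -/c.
have g0 : 0 <= growth * (1 + (T + 1) * c).
  rewrite mulr_ge0 ?expR_ge0// addr_ge0// mulr_ge0// addr_ge0//; exact: ltW.
have -> : B / eps = growth * (1 + (T + 1) * c) * eps.
  by rewrite /B; field; rewrite gt_eqF.
rewrite (_ : N%:R * _ = N%:R * tau * (c + growth * (1 + (T + 1) * c)) * eps +
  N%:R * tau * c * tau); last by ring.
have h1 : N%:R * tau * (c + growth * (1 + (T + 1) * c)) * eps <=
    (T + 1) * (c + growth * (1 + (T + 1) * c)) * eps.
  by rewrite ler_wpM2r ?(ltW eps0)// ler_wpM2r// addr_ge0.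
have h2 : N%:R * tau * c * tau <= (T + 1) * c * eps ^+ 2.
  apply: ler_pM => //; [|exact: ltW|by rewrite ler_wpM2r].
  by rewrite mulr_ge0// mulr_ge0// ltW.
have h3 : (T + 1) * c * eps ^+ 2 <= (T + 1) * c * (2 * eps).
  by rewrite ler_wpM2l// mulr_ge0// addr_ge0// ltW.
have := le_trans eps2 eps_sq; rewrite /sup_const -/c -/growth.
by move: h1 h2 h3; lra.
Qed.

Lemma sup_const_ge0 : 0 <= sup_const.
Proof.
have T1 : 0 <= T + 1 by rewrite addr_ge0// ltW.
have g0 : 0 <= growth by exact: expR_ge0.
have t0 : 0 <= (T + 1) * c by exact: mulr_ge0.
have t1 : 0 <= (T + 1) * (c + growth * (1 + (T + 1) * c)).
  by apply: mulr_ge0 => //; apply: addr_ge0 => //; apply: mulr_ge0 => //; exact: addr_ge0.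
have t2 : 0 <= 2 * (T + 1) * c by rewrite mulr_ge0// mulr_ge0.
by rewrite addr_ge0// addr_ge0.
Qed.

End Constants.

Unset Implicit Arguments.

Theorem theorem5p7 (R : realType) (lam L T : R) :
  0 < L -> 0 < T ->
  exists C : R,
  forall (X : completeNormedModType R) (ip : X -> X -> R),
  hilbert_ip R X ip -> separable_space X ->
  forall F : set (probability (TX R X) R),
  MPVF R X F ->
  tot_dissipative R X ip lam (bar_field R X ip F) ->
  forall tau : R, 0 < tau -> Num.max lam 0 * tau <= 2 -> tau < 1 ->
  forall mu1 mu2 : probability (BXm R X) R,
  inD R X F mu1 -> inD R X F mu2 ->
  (W2 distX mu1 mu2 < 1%:E)%E ->
  forall eta1 eta2 : probability (BCX R X T) R,
  scheme_curve_law R X F tau T L mu1 eta1 ->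
  scheme_curve_law R X F tau T L mu2 eta2 ->
  (W2 (distCX R X T) eta1 eta2
     <= C%:E * (sqrte (W2 distX mu1 mu2) + (tau `^ (4^-1))%:E))%E.
Proof.
move=> L0 T0; exists (Num.sqrt (sup_const lam L T)).
move=> X ip hip sepX F _ diss tau tau0 _ tau1 mu1 mu2 _ _ W1 eta1 eta2.
move=> [M1 [Phi1 [al1 [sol1 [ms1 eta1E]]]]] [M2 [Phi2 [al2 [sol2 [ms2 eta2E]]]]].
(* The slack in the choice of the initial coupling is [tau], the size of the error that the scheme
   makes anyway. *)
have [w [w0 wE [g cg gw]]] := W2_near_optimal tau0 (lt_trans W1 (ltry 1)).
have w1 : w < 1 by rewrite -lte_fin -wE.
pose N := Nsteps R tau T.
have [K1 C1] := scheme_euler_chain hip sepX tau0 T0 L0 sol1 ms1.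
have [K2 C2] := scheme_euler_chain hip sepX tau0 T0 L0 sol2 ms2.
have cg' : coupling (M1 0%N) (M2 0%N) g.
  by split => A mA; [rewrite cg.1// sol1.1|rewrite cg.2// sol2.1].
pose eps := w + Num.sqrt tau.
have eps0 : 0 < eps by rewrite ltr_wpDl// sqrtr_gt0.
have [A [S [cA _ mS Sk SA]]] := chain_coupling hip sepX diss tau0 C1 C2 cg' eps0
  gw (dist_bound_le lam L T0 tau0 tau1 w0) (leqnn N).
(* [chain_law] departs from the given laws at index 0 only, and the number of steps is positive. *)
have lawS (M0 : probability (BXm R X) R) al n :
    (0 < n)%N -> chain_law M0 al n = al n by case: n.
rewrite !lawS ?(Nsteps_gt0 tau0 T0)// in cA.
have mG := measurable_Gpath tau0 T0 sepX.
have mGG : measurable_fun setT (fun p : Xp R X N * Xp R X N =>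
    (Gpath R X tau T N p.1, Gpath R X tau T N p.2)).
  apply: measurable_fun_pair; first exact: (measurableT_comp mG measurable_fst).
  exact: (measurableT_comp mG measurable_snd).
have mGB B : measurable B -> measurable (Gpath R X tau T N @^-1` B).
  by move=> mB; have := mG measurableT _ mB; rewrite setTI.
have cgam : coupling eta1 eta2 (pushp A mGG).
  split => B mB.
    by rewrite eta1E// /pushforward -(cA.1 _ (mGB _ mB)).
  by rewrite eta2E// /pushforward -(cA.2 _ (mGB _ mB)).
have Wle : (W2 (distCX R X T) eta1 eta2 <=
    sqrte (sup_const lam L T * eps)%:E)%E.
  rewrite lee_sqrt; last by rewrite lee_fin mulr_ge0 ?sup_const_ge0// ltW.
  apply: ereal_inf_le; exists (\int[pushp A mGG]_p
    ((distCX R X T p.1 p.2) ^+ 2)%:E)%E; first by exists (pushp A mGG).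
  (* [S] bounds the squared distance at every node, hence the squared supremum distance of the
     interpolated curves. *)
  apply: (@le_trans _ _ (\int[A]_p (S p)%:E)%E).
    apply: integral_pushp_le; first exact/measurable_EFinP.
      by move=> p; rewrite lee_fin sqr_ge0.
    move=> p; rewrite lee_fin.
    have S0 : 0 <= S p by apply: le_trans (Sk p 0%N); exact: sqr_ge0.
    have kS k : (k <= N)%N ->
        `|Defs.coord R X N p.1 k - Defs.coord R X N p.2 k| <= Num.sqrt (S p).
      by move=> _; rewrite -[leLHS]ger0_norm// -sqrtr_sqr ler_wsqrtr.
    have /andP[d0 dS] := supdist_Gpath_le tau0 T0 kS.
    by rewrite -(sqr_sqrtr S0) lerXn2r ?nnegrE ?sqrtr_ge0.
  apply: le_trans SA _; rewrite lee_fin.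
  exact: sup_bound_le.
apply: le_trans Wle _; rewrite wE.
(* The fourth root arises as the square root taken in [W2] applied to the term [Num.sqrt tau] of
   [eps]. *)
rewrite (_ : tau `^ 4^-1 = Num.sqrt (Num.sqrt tau)); last first.
  rewrite -!powR12_sqrt ?sqrtr_ge0 ?powR_ge0 ?(ltW tau0)// -powRrM.
  by congr (_ `^ _); field.
rewrite /= -EFinD -EFinM lee_fin sqrtrM ?sup_const_ge0// ler_wpM2l ?sqrtr_ge0//.
by apply: sqrtrD_le => //; exact: sqrtr_ge0.
Qed.
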